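(* Let $\mathcal{X}\subseteq\mathbb{R}^{d_1}$ be non-empty, closed and convex, and let $f_t,g_t:\mathcal{X}\times\mathbb{R}^{d_2}\to\mathbb{R}$, $t\in[T]$. Assume that for all $t\in[T]$ and all $\mathbf{z}=[\mathbf{x};\mathbf{y}]$, $\mathbf{z}'=[\mathbf{x}';\mathbf{y}']$ in $\mathcal{X}\times\mathbb{R}^{d_2}$: (i) $|f_t(\mathbf{z})-f_t(\mathbf{z}')|\le \ell_{f,0}\|\mathbf{z}-\mathbf{z}'\|$; (ii) $\mathbf{y}\mapsto g_t(\mathbf{x},\mathbf{y})$ is $\mu_g$-strongly convex with $\mu_g>0$; (iii) $\nabla f_t$, $\nabla g_t$, $\nabla^2 g_t$ are Lipschitz continuous in $\mathbf{z}$ with constants $\ell_{f,1},\ell_{g,1},\ell_{g,2}$ respectively; (iv) $\|\mathbf{x}-\mathbf{x}'\|\le D$ for all $\mathbf{x},\mathbf{x}'\in\mathcal{X}$, and the initialization satisfies $\|\mathbf{y}_1-\mathbf{y}_1^*(\mathbf{x}_1)\|\le D'$; (v) the functions $\mathbf{x}\mapsto f_t(\mathbf{x},\mathbf{y}_t^*(\mathbf{x}))$, $t\in[T]$, are convex on $\mathcal{X}$; (vi) for every $t\in[T]$ there exists $(\mathbf{x}_t^*,\mathbf{y}_t^*(\mathbf{x}_t^* ))\in\mathcal{X}\times\mathbb{R}^{d_2}$ such that $\nabla f_t(\mathbf{x}_t^*,\mathbf{y}_t^*(\mathbf{x}_t^* ))=0$. Run OAGD (with window size $w=1$) with, for all $t\in[T]$,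 $$\beta_t=\beta=\frac{2}{\ell_{g,1}+\mu_g},\qquad \alpha_t=\alpha\le\frac{1}{4L_f},\qquad K_t>\big\lceil 0.25(\kappa_g+1)\log 4t^2\big\rceil .$$ Then $$\mathrm{BD\text{-}Reg}_T\le\mathcal{O}\big(1+S_{1,T}+Y_{2,T}\big).$$
   Context: Notation: $[T]=\{1,\dots,T\}$, $\|\cdot\|$ is the Euclidean (or induced operator) norm, $\kappa_g=\ell_{g,1}/\mu_g$. Assumption (iii) implicitly includes that $f_t$ is differentiable and $g_t$ twice differentiable. $\mathbf{y}_t^*(\mathbf{x})=\arg\min_{\mathbf{y}\in\mathbb{R}^{d_2}}g_t(\mathbf{x},\mathbf{y})$ and $\mathbf{x}_t^*\in\arg\min_{\mathbf{x}\in\mathcal{X}}f_t(\mathbf{x},\mathbf{y}_t^*(\mathbf{x}))$ is the minimizer in (vi). $\nabla f_t(\mathbf{x},\mathbf{y}_t^*(\mathbf{x}))$ is the gradient of $\mathbf{x}\mapsto f_t(\mathbf{x},\mathbf{y}_t^*(\mathbf{x}))$, i.e. $\nabla_{\mathbf{x}}f_t(\mathbf{x},\mathbf{y}_t^*(\mathbf{x}))+\nabla\mathbf{y}_t^*(\mathbf{x})\nabla_{\mathbf{y}}f_t(\mathbf{x},\mathbf{y}_t^*(\mathbf{x}))$. Constants: $M_f=\ell_{f,1}+\frac{\ell_{g,1}\ell_{f,1}}{\mu_g}+\frac{\ell_{f,0}}{\mu_g}\big(\ell_{g,2}+\frac{\ell_{g,1}\ell_{g,2}}{\mu_g}\big)$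 and $L_f=\ell_{f,1}+\frac{\ell_{g,1}(\ell_{f,1}+M_f)}{\mu_g}+\frac{\ell_{f,0}}{\mu_g}\big(\ell_{g,2}+\frac{\ell_{g,1}\ell_{g,2}}{\mu_g}\big)$. Approximate hypergradient: $\tilde\nabla f_t(\mathbf{x},\mathbf{y})=\nabla_{\mathbf{x}}f_t(\mathbf{x},\mathbf{y})+\mathbf{M}_t(\mathbf{x},\mathbf{y})\nabla_{\mathbf{y}}f_t(\mathbf{x},\mathbf{y})$, where $\mathbf{M}_t(\mathbf{x},\mathbf{y})\in\mathbb{R}^{d_1\times d_2}$ solves $\mathbf{M}_t(\mathbf{x},\mathbf{y})\nabla^2_{\mathbf{y}}g_t(\mathbf{x},\mathbf{y})+\nabla^2_{\mathbf{x}\mathbf{y}}g_t(\mathbf{x},\mathbf{y})=0$. OAGD (online alternating gradient descent) with $w=1$: start from $(\mathbf{x}_1,\mathbf{y}_1)\in\mathcal{X}\times\mathbb{R}^{d_2}$. For $t=1,\dots,T$: set $\mathbf{z}_t^1=\mathbf{y}_t$; for $k=1,\dots,K_t$ set $\mathbf{z}_t^{k+1}=\mathbf{z}_t^k-\beta_t\nabla_{\mathbf{y}}g_t(\mathbf{x}_t,\mathbf{z}_t^k)$; set $\mathbf{y}_{t+1}=\mathbf{z}_t^{K_t+1}$ and $\mathbf{x}_{t+1}=\Pi_{\mathcal{X}}[\mathbf{x}_t-\alpha_t\tilde\nabla f_t(\mathbf{x}_t,\mathbf{y}_{t+1})]$, with $\Pi_{\mathcal{X}}$ the Euclidean projection.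 Stepsizes $\alpha_t,\beta_t$ are positive. Bilevel dynamic regret: $\mathrm{BD\text{-}Reg}_T=\sum_{t=1}^T\big(f_t(\mathbf{x}_t,\mathbf{y}_t^*(\mathbf{x}_t))-f_t(\mathbf{x}_t^*,\mathbf{y}_t^*(\mathbf{x}_t^* ))\big)$. Path-lengths: $P_{p,T}=\sum_{t=2}^T\|\mathbf{x}_{t-1}^*-\mathbf{x}_t^*\|^p$, $Y_{p,T}=\sum_{t=2}^T\|\mathbf{y}_{t-1}^*(\mathbf{x}_{t-1}^* )-\mathbf{y}_t^*(\mathbf{x}_t^* )\|^p$, $S_{p,T}=P_{p,T}+Y_{p,T}$. The constant hidden in $\mathcal{O}$ depends only on $\ell_{f,0},\ell_{f,1},\ell_{g,1},\ell_{g,2},\mu_g,D,D',\alpha$ and not on $T$ or otherwise on the function sequence. *)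

(* Defs.v *)
From HB Require Import structures.
From mathcomp Require Import all_boot all_order all_algebra.
From mathcomp Require Import all_classical all_reals all_analysis.
Set Implicit Arguments.
Unset Strict Implicit.
Unset Printing Implicit Defensive.
Import Order.TTheory GRing.Theory Num.Theory.
Import numFieldNormedType.Exports.
Local Open Scope classical_set_scope.
Local Open Scope ring_scope.

(* The norm [`| |] that the library puts on matrices is the max-norm, so the
   Euclidean and operator norms are defined here.  Both induce the library
   topology, and little-o is insensitive to the choice of norm. *)
Definition dot {R : realType} {n : nat} (u v : 'cV[R]_n) : R :=
  \sum_(i < n) u i 0 * v i 0.

Definition norm2 {R : realType} {n : nat} (u : 'cV[R]_n) : R :=
  Num.sqrt (dot u u).

Definition opnorm {R : realType} {m n : nat} (A : 'M[R]_(m, n)) : R :=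
  sup [set norm2 (A *m v) | v in [set v : 'cV[R]_n | norm2 v <= 1]].

(* Frechet derivatives relative to a set [A], in general not open: increments
   are only taken inside [A].  At an interior point of [A] these are the usual
   gradient and Jacobian. *)
Definition has_gradient_within {R : realType} {n : nat} (A : set 'cV[R]_n)
    (h : 'cV[R]_n -> R) (z G : 'cV[R]_n) : Prop :=
  let F := within A (nbhs z) in
  (fun z' => h z' - h z - dot G (z' - z) : R^o) =o_F (fun z' => z' - z).

Definition has_jacobian_within {R : realType} {m n : nat} (A : set 'cV[R]_n)
    (h : 'cV[R]_n -> 'cV[R]_m) (z : 'cV[R]_n) (J : 'M[R]_(m, n)) : Prop :=
  let F := within A (nbhs z) in
  (fun z' => h z' - h z - J *m (z' - z)) =o_F (fun z' => z' - z).

(* X x R^d2, a point z = [x; y] being encoded as [col_mx x y]. *)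
Definition cylinder {R : realType} {d1 d2 : nat} (X : set 'cV[R]_d1) :
    set 'cV[R]_(d1 + d2) :=
  [set z | X (usubmx z)].

Definition strongly_convex {R : realType} {n : nat} (mu : R)
    (h : 'cV[R]_n -> R) : Prop :=
  forall (u v : 'cV[R]_n) (s : R), 0 <= s <= 1 ->
    h (s *: u + (1 - s) *: v) <=
      s * h u + (1 - s) * h v - mu / 2 * s * (1 - s) * norm2 (u - v) ^+ 2.

Definition is_argmin {R : realType} {n : nat} (A : set 'cV[R]_n)
    (h : 'cV[R]_n -> R) (u : 'cV[R]_n) : Prop :=
  A u /\ forall v, A v -> h u <= h v.

Definition is_projection {R : realType} {n : nat} (A : set 'cV[R]_n)
    (v p : 'cV[R]_n) : Prop :=
  is_argmin A (fun q => norm2 (v - q)) p.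

Section Blocks.
Context {R : realType} {d1 d2 : nat}.

Definition grad_x (G : 'cV[R]_(d1 + d2) -> 'cV[R]_(d1 + d2))
    (x : 'cV[R]_d1) (y : 'cV[R]_d2) : 'cV[R]_d1 := usubmx (G (col_mx x y)).

Definition grad_y (G : 'cV[R]_(d1 + d2) -> 'cV[R]_(d1 + d2))
    (x : 'cV[R]_d1) (y : 'cV[R]_d2) : 'cV[R]_d2 := dsubmx (G (col_mx x y)).

Definition hess_yy (H : 'cV[R]_(d1 + d2) -> 'M[R]_(d1 + d2))
    (x : 'cV[R]_d1) (y : 'cV[R]_d2) : 'M[R]_d2 := drsubmx (H (col_mx x y)).

(* [H] is the Jacobian of the gradient, so its lower left block has entries
   d/dx_j (d/dy_i); transposing gives (d^2/dx_i dy_j), a d1 x d2 matrix. *)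
Definition hess_xy (H : 'cV[R]_(d1 + d2) -> 'M[R]_(d1 + d2))
    (x : 'cV[R]_d1) (y : 'cV[R]_d2) : 'M[R]_(d1, d2) :=
  (dlsubmx (H (col_mx x y)))^T.

Definition hypergrad (G : 'cV[R]_(d1 + d2) -> 'cV[R]_(d1 + d2))
    (M : 'cV[R]_d1 -> 'cV[R]_d2 -> 'M[R]_(d1, d2))
    (x : 'cV[R]_d1) (y : 'cV[R]_d2) : 'cV[R]_d1 :=
  grad_x G x y + M x y *m grad_y G x y.

(* Online alternating gradient descent with window size 1; time starts at 1,
   and [iter (K t)] performs the inner steps z^1 = y_t, ..., z^(K_t + 1). *)
Definition oagd (T : nat) (X : set 'cV[R]_d1)
    (gradf gradg : nat -> 'cV[R]_(d1 + d2) -> 'cV[R]_(d1 + d2))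
    (M : nat -> 'cV[R]_d1 -> 'cV[R]_d2 -> 'M[R]_(d1, d2))
    (alpha beta : nat -> R) (K : nat -> nat)
    (x : nat -> 'cV[R]_d1) (y : nat -> 'cV[R]_d2) : Prop :=
  X (x 1%N) /\
  forall t, (1 <= t <= T)%N ->
    y t.+1 =
      iter (K t) (fun z => z - beta t *: grad_y (gradg t) (x t) z) (y t) /\
    is_projection X
      (x t - alpha t *: hypergrad (gradf t) (M t) (x t) (y t.+1)) (x t.+1).

Definition outer (f : 'cV[R]_(d1 + d2) -> R) (ystar : 'cV[R]_d1 -> 'cV[R]_d2)
    (x : 'cV[R]_d1) : R :=
  f (col_mx x (ystar x)).

Definition BD_Reg (T : nat) (f : nat -> 'cV[R]_(d1 + d2) -> R)
    (ystar : nat -> 'cV[R]_d1 -> 'cV[R]_d2) (x xstar : nat -> 'cV[R]_d1) : R :=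
  \sum_(1 <= t < T.+1)
    (outer (f t) (ystar t) (x t) - outer (f t) (ystar t) (xstar t)).

Definition path_P (p T : nat) (xstar : nat -> 'cV[R]_d1) : R :=
  \sum_(2 <= t < T.+1) norm2 (xstar t.-1 - xstar t) ^+ p.

Definition path_Y (p T : nat) (ystar : nat -> 'cV[R]_d1 -> 'cV[R]_d2)
    (xstar : nat -> 'cV[R]_d1) : R :=
  \sum_(2 <= t < T.+1)
    norm2 (ystar t.-1 (xstar t.-1) - ystar t (xstar t)) ^+ p.

Definition path_S (p T : nat) (ystar : nat -> 'cV[R]_d1 -> 'cV[R]_d2)
    (xstar : nat -> 'cV[R]_d1) : R :=
  path_P p T xstar + path_Y p T ystar xstar.

End Blocks.

Definition const_Mf {R : realType} (lf0 lf1 lg1 lg2 mu : R) : R :=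
  lf1 + lg1 * lf1 / mu + lf0 / mu * (lg2 + lg1 * lg2 / mu).

Definition const_Lf {R : realType} (lf0 lf1 lg1 lg2 mu : R) : R :=
  lf1 + lg1 * (lf1 + const_Mf lf0 lf1 lg1 lg2 mu) / mu
    + lf0 / mu * (lg2 + lg1 * lg2 / mu).

(* Main.v *)
Require Import Defs.
From mathcomp Require Import all_boot all_order all_algebra.
From mathcomp Require Import all_classical all_reals all_analysis.
From mathcomp Require Import ring lra.
Import Order.TTheory GRing.Theory Num.Theory.
Import numFieldNormedType.Exports.
Local Open Scope classical_set_scope.
Local Open Scope ring_scope.
Set Implicit Arguments.
Unset Strict Implicit.

(** Write [F_t x = f_t (x, y_t* x)] for the outer objective, [p_t = x_t*] for its
    minimiser, [h_t] for the approximate hypergradient of round [t], and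
    [kappa = lg1 / mu].

    One round.  With [w = x_(t+1) - x_t], the variational inequality of the
    projection reads
    [2 alpha <h_t, x_(t+1) - p_t> <= |x_t - p_t|^2 - |x_(t+1) - p_t|^2 - |w|^2].
    By convexity the gap [F_t x_t - F_t p_t] is at most the linearised gap
    [P = <grad F_t x_t, x_t - p_t>].  Replacing [h_t] by [grad F_t x_t] costs the
    hypergradient error, and the term [- <grad F_t x_t, w>] remains.  For a
    function smooth and convex on the whole space it would be controlled by
    [|grad F|^2 <= 2 L (F x - F p)], but the proof of that inequality evaluates
    [F] outside [X].  Lemma [constrained_self_bounding] replaces it: since
    [grad F_t p_t = 0] along [X], the term is at most [P / 2 + 2 L |w|^2], and
    [alpha <= 1 / (4 L)] absorbs the square.  So (lemma [oagd_round]) the gap is at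
    most [(|x_t - p_t|^2 - |x_(t+1) - p_t|^2) / alpha] plus twice the error.

    The hypergradient.  [X] may have empty interior, and then the derivatives in
    [x] are determined by [f] and [g] only up to vectors orthogonal to [X - X].
    Gradients are therefore only tested against differences [a - b] of points
    of [X].  In this sense the hypergradient is [const_Mf]-Lipschitz in [(x, y)]
    ([hypergrad_lip]), it is the derivative of [F_t] on the graph of [y_t*]
    ([outer_dir_deriv]), and [grad F_t] is [const_Lf]-Lipschitz
    ([outer_grad_lip]).  The matrix [M_t] is the transpose of the derivative of
    [y_t*] because the Hessian in [y] is symmetric ([hessian_sym]).

    The inner loop.  One inner step contracts the distance to [y_t* x_t] by
    [1 - u], with [u = 2 / (kappa + 1)] ([gradient_step_contraction]), and
    [K_t u >= ln (2 t)].  From [1 - u <= exp (- u)] one would get the rate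
    [1 / (2 t)], and errors of total size [ln T].  But
    [1 - u <= exp (- u (1 + u / 4))], so the rate is in fact
    [(2 t)^-(1 + u / 4)], which is summable ([contraction_le_inner_rate],
    [inner_rate_sum]).  Per round the lower-level target drifts by at most
    [2 kappa D] plus an increment of [Y_1], so the errors sum up to
    [O (1 + Y_1)] ([tracking_error_sum]).

    Summation.  The differences of squares telescope up to the motion of the
    comparator, which gives [D^2 + 2 D P_1] ([drifting_telescope]). *)

(** * Euclidean space *)

Section EuclideanSpace.
Context {R : realType}.

Lemma dotC (n : nat) (u v : 'cV[R]_n) : dot u v = dot v u.
Proof. by apply: eq_bigr => i _; rewrite mulrC. Qed.

Lemma dotDr (n : nat) (u v w : 'cV[R]_n) : dot u (v + w) = dot u v + dot u w.
Proof. by rewrite -big_split; apply: eq_bigr => i _; rewrite mxE mulrDr. Qed.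

Lemma dotZr (n : nat) (a : R) (u v : 'cV[R]_n) : dot u (a *: v) = a * dot u v.
Proof. by rewrite /dot mulr_sumr; apply: eq_bigr => i _; rewrite mxE mulrCA. Qed.

Lemma dotNr (n : nat) (u v : 'cV[R]_n) : dot u (- v) = - dot u v.
Proof. by rewrite -scaleN1r dotZr mulN1r. Qed.

Lemma dotBr (n : nat) (u v w : 'cV[R]_n) : dot u (v - w) = dot u v - dot u w.
Proof. by rewrite dotDr dotNr. Qed.

Lemma dotDl (n : nat) (u v w : 'cV[R]_n) : dot (u + v) w = dot u w + dot v w.
Proof. by rewrite dotC dotDr !(dotC w). Qed.

Lemma dotZl (n : nat) (a : R) (u v : 'cV[R]_n) : dot (a *: u) v = a * dot u v.
Proof. by rewrite dotC dotZr dotC. Qed.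

Lemma dotNl (n : nat) (u v : 'cV[R]_n) : dot (- u) v = - dot u v.
Proof. by rewrite dotC dotNr dotC. Qed.

Lemma dotBl (n : nat) (u v w : 'cV[R]_n) : dot (u - v) w = dot u w - dot v w.
Proof. by rewrite dotDl dotNl. Qed.

Lemma dot0l (n : nat) (u : 'cV[R]_n) : dot 0 u = 0.
Proof. by rewrite -(scale0r 0) dotZl mul0r. Qed.

Lemma dot0r (n : nat) (u : 'cV[R]_n) : dot u 0 = 0.
Proof. by rewrite dotC dot0l. Qed.

Definition dotE := (dotDr, dotDl, dotNr, dotNl, dotZr, dotZl).

Lemma dot_ge0 (n : nat) (u : 'cV[R]_n) : 0 <= dot u u.
Proof. by apply: sumr_ge0 => i _; rewrite -expr2 sqr_ge0. Qed.

Lemma dot_mulmxl (m n : nat) (A : 'M[R]_(m, n)) (u : 'cV[R]_n) (v : 'cV[R]_m) :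
  dot (A *m u) v = dot u (A^T *m v).
Proof.
rewrite /dot.
under eq_bigr => i _ do rewrite mxE mulr_suml.
rewrite exchange_big /=; apply: eq_bigr => j _.
rewrite mxE mulr_sumr; apply: eq_bigr => i _.
by rewrite !mxE mulrCA mulrA.
Qed.

Lemma dot_col_mx (m n : nat) (a c : 'cV[R]_m) (b d : 'cV[R]_n) :
  dot (col_mx a b) (col_mx c d) = dot a c + dot b d.
Proof.
rewrite /dot big_split_ord /=.
by congr (_ + _); apply: eq_bigr => i _; rewrite ?col_mxEu ?col_mxEd.
Qed.

Lemma norm2_ge0 (n : nat) (u : 'cV[R]_n) : 0 <= norm2 u.
Proof. exact: sqrtr_ge0. Qed.

Lemma sqr_norm2 (n : nat) (u : 'cV[R]_n) : norm2 u ^+ 2 = dot u u.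
Proof. by rewrite sqr_sqrtr ?dot_ge0. Qed.

Lemma norm2Z (n : nat) (a : R) (u : 'cV[R]_n) : norm2 (a *: u) = `|a| * norm2 u.
Proof.
by rewrite /norm2 dotZl dotZr mulrA -expr2 sqrtrM ?sqr_ge0// sqrtr_sqr.
Qed.

Lemma norm2N (n : nat) (u : 'cV[R]_n) : norm2 (- u) = norm2 u.
Proof. by rewrite -scaleN1r norm2Z normrN1 mul1r. Qed.

Lemma norm2_distC (n : nat) (u v : 'cV[R]_n) : norm2 (u - v) = norm2 (v - u).
Proof. by rewrite -norm2N opprB. Qed.

Lemma norm2_0 (n : nat) : norm2 (0 : 'cV[R]_n) = 0.
Proof. by rewrite /norm2 dot0l sqrtr0. Qed.

Lemma norm2_eq0 (n : nat) (u : 'cV[R]_n) : norm2 u = 0 -> u = 0.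
Proof.
move=> u0; have /eqP : dot u u = 0 by rewrite -sqr_norm2 u0 expr0n.
rewrite psumr_eq0 => [/allP h|i _]; last by rewrite -expr2 sqr_ge0.
apply/matrixP => i j; rewrite (ord1 j) mxE.
by have /implyP/(_ isT) := h i (mem_index_enum i); rewrite mulf_eq0 orbb => /eqP.
Qed.

Lemma norm2_gt0 (n : nat) (u : 'cV[R]_n) : u != 0 -> 0 < norm2 u.
Proof.
rewrite lt_neqAle norm2_ge0 andbT [0 == _]eq_sym; apply: contra => /eqP u0.
by apply/eqP; exact: norm2_eq0.
Qed.

Lemma cauchy_schwarz (n : nat) (u v : 'cV[R]_n) :
  `|dot u v| <= norm2 u * norm2 v.
Proof.
rewrite -ler_sqr ?nnegrE ?mulr_ge0 ?norm2_ge0//.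
rewrite real_normK ?num_real// exprMn !sqr_norm2.
have [->|/norm2_gt0 v0] := eqVneq v 0; first by rewrite !dot0r expr0n mulr0.
have {v0} v0 : 0 < dot v v by rewrite -sqr_norm2 exprn_gt0.
have := dot_ge0 (dot v v *: u - dot u v *: v).
rewrite !dotE (dotC v u).
set c := (X in 0 <= X) => c0.
have {}c0 : 0 <= dot v v * (dot u u * dot v v - dot u v ^+ 2).
  by move: c0; congr (0 <= _); rewrite /c; ring.
by move: c0; rewrite pmulr_rge0// subr_ge0.
Qed.

Lemma dot_le (n : nat) (u v : 'cV[R]_n) : dot u v <= norm2 u * norm2 v.
Proof. exact: le_trans (ler_norm _) (cauchy_schwarz _ _). Qed.

Lemma norm2D (n : nat) (u v : 'cV[R]_n) : norm2 (u + v) <= norm2 u + norm2 v.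
Proof.
rewrite -ler_sqr ?nnegrE ?addr_ge0 ?norm2_ge0// sqrrD !sqr_norm2 !dotE.
have := dot_le u v; rewrite (dotC v u) => h; lra.
Qed.

Lemma norm2B (n : nat) (u v : 'cV[R]_n) : norm2 (u - v) <= norm2 u + norm2 v.
Proof. by rewrite -(norm2N v) norm2D. Qed.

Lemma norm2_tri (n : nat) (u v w : 'cV[R]_n) :
  norm2 (u - w) <= norm2 (u - v) + norm2 (v - w).
Proof. by rewrite -[u - w](subrKA v) norm2D. Qed.

Lemma norm2_le_dot (n : nat) (u : 'cV[R]_n) (c : R) :
  0 <= c -> (forall v, dot u v <= c * norm2 v) -> norm2 u <= c.
Proof.
move=> c0 h; have := h u; rewrite -sqr_norm2 expr2.
have [->|/norm2_gt0 u0] := eqVneq u 0; first by rewrite norm2_0.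
by rewrite ler_pM2r.
Qed.

Lemma norm2_col_mx0 (m n : nat) (a : 'cV[R]_m) :
  norm2 (col_mx a (0 : 'cV[R]_n)) = norm2 a.
Proof. by rewrite /norm2 dot_col_mx dot0l addr0. Qed.

Lemma norm2_col_0mx (m n : nat) (b : 'cV[R]_n) :
  norm2 (col_mx (0 : 'cV[R]_m) b) = norm2 b.
Proof. by rewrite /norm2 dot_col_mx dot0l add0r. Qed.

Lemma norm2_col_mx_le (m n : nat) (a : 'cV[R]_m) (b : 'cV[R]_n) :
  norm2 (col_mx a b) <= norm2 a + norm2 b.
Proof.
have -> : col_mx a b = col_mx a 0 + col_mx 0 b by rewrite add_col_mx addr0 add0r.
by rewrite (le_trans (norm2D _ _))// norm2_col_mx0 norm2_col_0mx.
Qed.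

Lemma norm2_usubmx (m n : nat) (u : 'cV[R]_(m + n)) :
  norm2 (usubmx u) <= norm2 u.
Proof.
rewrite -{2}[u]vsubmxK ler_wsqrtr// dot_col_mx lerDl; exact: dot_ge0.
Qed.

Lemma norm2_dsubmx (m n : nat) (u : 'cV[R]_(m + n)) :
  norm2 (dsubmx u) <= norm2 u.
Proof.
rewrite -{2}[u]vsubmxK ler_wsqrtr// dot_col_mx lerDr; exact: dot_ge0.
Qed.

Lemma coord_le_norm2 (n : nat) (u : 'cV[R]_n) (i : 'I_n) : `|u i 0| <= norm2 u.
Proof.
rewrite -sqrtr_sqr ler_wsqrtr// /dot (bigD1 i) //= expr2 lerDl.
by apply: sumr_ge0 => j _; rewrite -expr2 sqr_ge0.
Qed.

Lemma norm2_le_sum (n : nat) (u : 'cV[R]_n) : norm2 u <= \sum_i `|u i 0|.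
Proof.
rewrite -ler_sqr ?nnegrE ?norm2_ge0 ?sumr_ge0// sqr_norm2 expr2 mulr_suml.
apply: ler_sum => i _.
rewrite (le_trans (ler_norm _))// normrM ler_wpM2l//.
by rewrite (bigD1 i) //= lerDl sumr_ge0.
Qed.

Lemma mxnorm_le_norm2 (n : nat) (u : 'cV[R]_n) : `|u| <= norm2 u.
Proof.
rewrite /Num.norm /= mx_normrE; apply: bigmax_le; first exact: norm2_ge0.
by move=> [i j] _ /=; rewrite (ord1 j) coord_le_norm2.
Qed.

Lemma norm2_le_mxnorm (n : nat) (u : 'cV[R]_n) : norm2 u <= n%:R * `|u|.
Proof.
rewrite (le_trans (norm2_le_sum _))//.
apply: (@le_trans _ _ (\sum_(i < n) `|u|)); last first.
  by rewrite sumr_const card_ord mulr_natl.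
apply: ler_sum => i _.
by rewrite /Num.norm /= mx_normrE (le_bigmax _ (fun k : 'I_n * 'I_1 => `|u k.1 k.2|) (i, 0)).
Qed.

(** The supremum defining [opnorm] is of a bounded set; otherwise its value
    would be a meaningless default. *)
Lemma opnorm_has_ubound (m n : nat) (A : 'M[R]_(m, n)) :
  has_ubound [set norm2 (A *m w) | w in [set w : 'cV[R]_n | norm2 w <= 1]].
Proof.
exists (\sum_i \sum_j `|A i j|) => _ [w /= w1 <-].
rewrite (le_trans (norm2_le_sum _))//; apply: ler_sum => i _.
rewrite mxE (le_trans (ler_norm_sum _ _ _))//; apply: ler_sum => j _.
by rewrite normrM ler_piMr// (le_trans (coord_le_norm2 _ _)).
Qed.

Lemma opnorm_ge0 (m n : nat) (A : 'M[R]_(m, n)) : 0 <= opnorm A.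
Proof.
apply: (ub_le_sup (opnorm_has_ubound A)); exists 0 => /=.
  by rewrite norm2_0 ler01.
by rewrite mulmx0 norm2_0.
Qed.

Lemma norm2_mulmx_le (m n : nat) (A : 'M[R]_(m, n)) (v : 'cV[R]_n) :
  norm2 (A *m v) <= opnorm A * norm2 v.
Proof.
have [->|v0] := eqVneq v 0; first by rewrite mulmx0 !norm2_0 mulr0.
have v1 := norm2_gt0 v0.
have : norm2 (A *m ((norm2 v)^-1 *: v)) <= opnorm A.
  apply: (ub_le_sup (opnorm_has_ubound A)); exists ((norm2 v)^-1 *: v) => //=.
  by rewrite norm2Z ger0_norm ?invr_ge0 ?norm2_ge0// mulVf// gt_eqF.
rewrite -scalemxAr norm2Z ger0_norm ?invr_ge0 ?norm2_ge0//.
by rewrite mulrC ler_pdivrMr.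
Qed.

End EuclideanSpace.

(** * Derivatives along segments *)

Section Derivatives.
Context {R : realType}.

Lemma within_littleo (n : nat) (A : set 'cV[R]_n) (z : 'cV[R]_n)
    (V : normedModType R) (r : 'cV[R]_n -> V) :
  (let F := within A (nbhs z) in r =o_F (fun z' => z' - z)) ->
  forall e, 0 < e -> exists2 d, 0 < d &
    forall z', A z' -> norm2 (z' - z) < d -> `|r z'| <= e * norm2 (z' - z).
Proof.
move=> /= /eqoP h e e0; have /nbhs_ballP[d /= d0 hd] := h e e0.
exists d => // z' Az' z'd.
have : `|r z'| <= e * `|z' - z|.
  apply: hd => //; rewrite -ball_normE /= distrC.
  by rewrite (le_lt_trans (mxnorm_le_norm2 _)).
by move=> /le_trans; apply; rewrite ler_pM2l// mxnorm_le_norm2.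
Qed.

Lemma gradient_epsilon (n : nat) (A : set 'cV[R]_n) (h : 'cV[R]_n -> R)
    (z G : 'cV[R]_n) :
  has_gradient_within A h z G ->
  forall e, 0 < e -> exists2 d, 0 < d &
    forall z', A z' -> norm2 (z' - z) < d ->
      `|h z' - h z - dot G (z' - z)| <= e * norm2 (z' - z).
Proof. by move=> /within_littleo. Qed.

(** Differentiability relative to [A] in epsilon-delta form and in the Euclidean
    norm, so that no constant depending on the dimension appears later. *)
Definition frechet (m n : nat) (A : set 'cV[R]_n) (h : 'cV[R]_n -> 'cV[R]_m)
    (z : 'cV[R]_n) (J : 'M[R]_(m, n)) :=
  forall e, 0 < e -> exists2 d, 0 < d &
    forall z', A z' -> norm2 (z' - z) < d ->
      norm2 (h z' - h z - J *m (z' - z)) <= e * norm2 (z' - z).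

Lemma jacobian_frechet (m n : nat) (A : set 'cV[R]_n) (h : 'cV[R]_n -> 'cV[R]_m)
    (z : 'cV[R]_n) (J : 'M[R]_(m, n)) :
  has_jacobian_within A h z J -> frechet A h z J.
Proof.
move=> /within_littleo hJ e e0.
have e1 : 0 < e / m.+1%:R by rewrite divr_gt0.
have [d d0 hd] := hJ _ e1; exists d => // z' Az' z'd.
rewrite (le_trans (norm2_le_mxnorm _))//.
rewrite (@le_trans _ _ (m.+1%:R * (e / m.+1%:R * norm2 (z' - z))))//.
  by rewrite ler_pM ?hd// ler_nat.
by rewrite mulrA mulrCA mulfV ?mulr1// gt_eqF.
Qed.

(** One-sided derivative, along [w] only: at a boundary point of a convex set the
    increments in the opposite direction may leave the set. *)
Definition dir_deriv (n : nat) (h : 'cV[R]_n -> R) (z w : 'cV[R]_n) (l : R) :=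
  forall e, 0 < e -> exists2 s0, 0 < s0 &
    forall s, 0 < s <= s0 -> `|h (z + s *: w) - h z - s * l| <= e * s.

Lemma small_step (d b : R) : 0 < d -> 0 <= b ->
  exists2 s0, 0 < s0 <= 1 & forall s, 0 < s <= s0 -> s * b < d.
Proof.
move=> d0 b0; exists (Num.min 1 (d / (b + 1))).
  by rewrite lt_min ltr01 divr_gt0 ?ltr_wpDl//= ge_min lexx.
move=> s /andP[s0]; rewrite le_min => /andP[_].
rewrite ler_pdivlMr ?ltr_wpDl// => h; apply: lt_le_trans h.
by rewrite mulrDr mulr1 ltrDl.
Qed.

Lemma gradient_dir_deriv (n : nat) (A : set 'cV[R]_n) (h : 'cV[R]_n -> R)
    (z w G : 'cV[R]_n) :
  (forall s, 0 < s <= 1 -> A (z + s *: w)) ->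
  has_gradient_within A h z G -> dir_deriv h z w (dot G w).
Proof.
move=> Aw /gradient_epsilon hG e e0.
have e1 : 0 < e / (norm2 w + 1) by rewrite divr_gt0// ltr_wpDl ?norm2_ge0.
have [d d0 hd] := hG _ e1.
have [s1 /andP[s10 s11] hs1] := small_step d0 (norm2_ge0 w).
exists s1 => // s /andP[s0 ss1].
have := hd (z + s *: w); rewrite addrAC subrr add0r norm2Z gtr0_norm// dotZr.
move=> hle; apply: (le_trans (hle _ _)).
- by apply: Aw; rewrite s0 (le_trans ss1).
- by rewrite hs1 ?s0.
rewrite -mulrA ler_pM2l// mulrCA -[leRHS]mulr1 ler_pM2l// mulrC.
by rewrite ler_pdivrMr ?mul1r ?lerDl// ltr_wpDl ?norm2_ge0.
Qed.

Lemma dir_deriv_unique (n : nat) (h : 'cV[R]_n -> R) (z w : 'cV[R]_n) (l k : R) :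
  dir_deriv h z w l -> dir_deriv h z w k -> l = k.
Proof.
suff le_lk l' k' : dir_deriv h z w l' -> dir_deriv h z w k' -> l' <= k'.
  by move=> hl hk; apply: le_anti; rewrite !le_lk.
move=> hl hk; apply/ler_addgt0Pr => e e0.
have e2 : 0 < e / 2 by rewrite divr_gt0.
have [a a0 ha] := hl _ e2; have [b b0 hb] := hk _ e2.
have s0 : 0 < Num.min a b by rewrite lt_min a0 b0.
have := ha (Num.min a b); rewrite s0 ge_min lexx => /(_ isT).
have := hb (Num.min a b); rewrite s0 ge_min lexx orbT => /(_ isT).
rewrite !ler_norml => /andP[h1 h2] /andP[h3 h4].
by rewrite -(ler_pM2l s0); lra.
Qed.

(** Convexity ([c = 0]) and strong convexity ([c = mu / 2 |w|^2]) become
    first-order inequalities: divide by [s] and let [s] tend to [0]. *)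
Lemma dir_deriv_chord (n : nat) (h : 'cV[R]_n -> R) (z w : 'cV[R]_n) (l c : R) :
  (forall s, 0 <= s <= 1 ->
    h (z + s *: w) <= (1 - s) * h z + s * h (z + w) - c * s * (1 - s)) ->
  dir_deriv h z w l -> l + c <= h (z + w) - h z.
Proof.
move=> hc hl; apply/ler_addgt0Pr => e e0.
have e2 : 0 < e / 2 by rewrite divr_gt0.
have [a a0 ha] := hl _ e2.
have [b /andP[b0 b1] hb] := small_step e2 (normr_ge0 c).
set s := Num.min a b.
have s0 : 0 < s by rewrite lt_min a0 b0.
have s1 : s <= 1 by rewrite ge_min b1 orbT.
have := ha s; rewrite s0 ge_min lexx => /(_ isT).
have := hb s; rewrite s0 ge_min lexx orbT => /(_ isT) h1.
have := hc s; rewrite (ltW s0) s1 => /(_ isT) h2.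
rewrite ler_norml => /andP[h3 _].
have h4 : c * s * s <= e / 2 * s.
  by rewrite ler_pM2r// mulrC (le_trans _ (ltW h1))// ler_pM2l// ler_norm.
rewrite -(ler_pM2l s0); lra.
Qed.

Lemma dir_deriv_le (n : nat) (h : 'cV[R]_n -> R) (z w : 'cV[R]_n) (l c : R) :
  (forall s, 0 < s <= 1 -> `|h (z + s *: w) - h z| <= s * c) ->
  dir_deriv h z w l -> l <= c.
Proof.
move=> hc hl; apply/ler_addgt0Pr => e e0; have [a a0 ha] := hl _ e0.
have s0 : 0 < Num.min a 1 by rewrite lt_min a0 ltr01.
have := ha (Num.min a 1); rewrite s0 ge_min lexx => /(_ isT).
have := hc (Num.min a 1); rewrite s0 ge_min lexx orbT => /(_ isT).
rewrite !ler_norml => /andP[h1 h2] /andP[h3 h4].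
by rewrite -(ler_pM2l s0); lra.
Qed.

Lemma dir_deriv_min (n : nat) (h : 'cV[R]_n -> R) (z w : 'cV[R]_n) (l : R) :
  (forall v, h z <= h v) -> dir_deriv h z w l -> 0 <= l.
Proof.
move=> hm hl; apply/ler_addgt0Pr => e e0; have [a a0 ha] := hl _ e0.
have := ha a; rewrite a0 lexx => /(_ isT); rewrite ler_norml => /andP[_ h2].
have h3 := hm (z + a *: w); rewrite -(ler_pM2l a0); lra.
Qed.

Lemma dir_deriv_mvt (n : nat) (h l : 'cV[R]_n -> R) (a w : 'cV[R]_n) :
  (forall z, dir_deriv h z w (l z)) ->
  (forall z, dir_deriv h z (- w) (- l z)) ->
  exists2 s, 0 <= s <= 1 & h (a + w) - h a = l (a + s *: w).
Proof.
move=> hp hn.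
pose psi (s : R) := h (a + s *: w).
have der (s : R) : is_derive s (1 : R) psi (l (a + s *: w)).
  have cvgd : (fun k : R => k^-1 *: ((psi \o shift s) (k *: (1 : R)) - psi s)) @ 0^' -->
      l (a + s *: w).
    apply/cvgrPdist_le => e e0.
    have [b b0 hb] := hp (a + s *: w) _ e0.
    have [c c0 hc] := hn (a + s *: w) _ e0.
    exists (Num.min b c) => /=; first by rewrite lt_min b0 c0.
    move=> k; rewrite /ball /= sub0r normrN lt_min => /andP[kb kc] k0.
    have -> : k^-1 *: ((psi \o shift s) (k *: (1 : R)) - psi s) =
        k^-1 * (h (a + s *: w + k *: w) - h (a + s *: w)).
      by rewrite /psi /= [k *: _]mulr1 scalerDl [k *: w + _]addrC addrA.
    set x := h _ - h _; set l0 := l _.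
    have hx : `|x - k * l0| <= e * `|k|.
      case: (ltrgtP k 0) k0 => // [kn|kp] _.
        have : 0 < - k <= c by rewrite oppr_gt0 kn -(ltr0_norm kn) ltW.
        by move=> /hc; rewrite (ltr0_norm kn) scaleNr scalerN opprK mulrNN.
      have : 0 < k <= b by rewrite kp (le_trans (ler_norm k))// ltW.
      by move=> /hb; rewrite (gtr0_norm kp).
    have k1 : 0 < `|k| by rewrite normr_gt0.
    rewrite -(ler_pM2l k1) -normrM mulrBr mulrA mulfV// mul1r.
    by rewrite -normrN opprB [leRHS]mulrC.
  apply: DeriveDef; first by apply/cvg_ex; exists (l (a + s *: w)).
  exact/cvg_lim.
have cont : {within `[0, 1], continuous psi}.
  by apply: derivable_within_continuous => s _; exact: (@ex_derive _ _ _ _ _ _ _ (der s)).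
have [c] := @MVT _ psi (fun s => l (a + s *: w)) 0 1 ltr01 (fun s _ => der s) cont.
rewrite in_itv /= => /andP[c0 c1]; rewrite /psi scale1r scale0r addr0 subr0 mulr1.
by exists c => //; rewrite !ltW.
Qed.

End Derivatives.

(** * Smooth strongly convex functions *)

Lemma addrKl (V : zmodType) (x y : V) : x + y - x = y.
Proof. by rewrite addrAC subrr add0r. Qed.

Section SmoothFunctions.
Context {R : realType} {n : nat}.
Implicit Types (h : 'cV[R]_n -> R) (G : 'cV[R]_n -> 'cV[R]_n).

Lemma sqr_norm2D (u v : 'cV[R]_n) :
  norm2 (u + v) ^+ 2 = norm2 u ^+ 2 + 2 * dot u v + norm2 v ^+ 2.
Proof. by rewrite !sqr_norm2 !dotE (dotC v u); ring. Qed.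

Lemma sqr_norm2B (u v : 'cV[R]_n) :
  norm2 (u - v) ^+ 2 = norm2 u ^+ 2 - 2 * dot u v + norm2 v ^+ 2.
Proof. by rewrite !sqr_norm2 !dotE (dotC v u); ring. Qed.

Lemma strongly_convex_tangent h mu u v l :
  strongly_convex mu h -> dir_deriv h u (v - u) l ->
  l + mu / 2 * norm2 (v - u) ^+ 2 <= h v - h u.
Proof.
move=> hsc hl.
rewrite -{2}[v](subrKC u); apply: dir_deriv_chord hl => s /andP[s0 s1].
rewrite (subrKC u).
have -> : u + s *: (v - u) = s *: v + (1 - s) *: u.
  by rewrite scalerBr scalerBl scale1r addrCA.
by apply: le_trans (hsc _ _ _ _) _; [rewrite s0 s1|lra].
Qed.

Lemma dir_deriv_subquad h (z w v : 'cV[R]_n) l c :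
  dir_deriv h z w l ->
  dir_deriv (fun x => h x - c * norm2 (x - v) ^+ 2) z w (l - 2 * c * dot (z - v) w).
Proof.
move=> hl e e0; have e2 : 0 < e / 2 by rewrite divr_gt0.
have [a a0 ha] := hl _ e2.
have [b /andP[b0 b1] hb] := small_step e2 (normr_ge0 (c * norm2 w ^+ 2)).
exists (Num.min a b) => [|s]; first by rewrite lt_min a0 b0.
rewrite le_min => /and3P[s0 sa sb].
have : 0 < s <= a by rewrite s0.
move=> /ha {}ha.
have : 0 < s <= b by rewrite s0.
move=> /hb {}hb.
have -> : z + s *: w - v = (z - v) + s *: w by rewrite addrAC.
rewrite sqr_norm2D norm2Z exprMn real_normK ?num_real// dotZr.
have -> : h (z + s *: w) - c * (norm2 (z - v) ^+ 2 + 2 * (s * dot (z - v) w)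
    + s ^+ 2 * norm2 w ^+ 2) - (h z - c * norm2 (z - v) ^+ 2)
    - s * (l - 2 * c * dot (z - v) w) =
  (h (z + s *: w) - h z - s * l) - s * (s * (c * norm2 w ^+ 2)) by ring.
rewrite (le_trans (ler_normB _ _))// [e]splitr mulrDl lerD//.
rewrite normrM (gtr0_norm s0) mulrC ler_pM2r//.
by rewrite normrM (gtr0_norm s0) ltW.
Qed.

(** Comparing [h] with the quadratic of curvature [ell] around [v] through the
    mean value theorem keeps the sharp constant [ell / 2]. *)
Lemma descent_lemma h G ell (v w : 'cV[R]_n) :
  (forall z p, dir_deriv h z p (dot (G z) p)) ->
  (forall z z', norm2 (G z - G z') <= ell * norm2 (z - z')) ->
  h (v + w) <= h v + dot (G v) w + ell / 2 * norm2 w ^+ 2.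
Proof.
move=> hG hL.
have [|z|s /andP[s0 s1]] := @dir_deriv_mvt _ _
  (fun x => h x - ell / 2 * norm2 (x - v) ^+ 2)
  (fun z => dot (G z) w - 2 * (ell / 2) * dot (z - v) w) v w.
- by move=> z; apply: dir_deriv_subquad.
- have := dir_deriv_subquad v (ell / 2) (hG z (- w)).
  by congr (dir_deriv _ _ _ _); rewrite !dotNr; ring.
rewrite /= !addrKl subrr norm2_0 expr0n /= mulr0 subr0 dotZl -sqr_norm2 => hs.
have : dot (G (v + s *: w) - G v) w <= ell * s * norm2 w ^+ 2.
  rewrite (le_trans (dot_le _ _))// expr2 mulrA ler_wpM2r ?norm2_ge0//.
  rewrite (le_trans (hL _ _))// addrKl norm2Z ger0_norm//.
  by rewrite mulrA.
rewrite dotBl => h1; lra.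
Qed.

(** Baillon-Haddad inequality for the convex, [(ell - mu)]-smooth function
    [h - mu / 2 * |.|^2]. *)
Lemma cocoercive_shift h G mu ell (u v : 'cV[R]_n) :
  mu <= ell ->
  (forall z p, dir_deriv h z p (dot (G z) p)) ->
  strongly_convex mu h ->
  (forall z z', norm2 (G z - G z') <= ell * norm2 (z - z')) ->
  norm2 (G v - G u - mu *: (v - u)) ^+ 2 <=
    (ell - mu) * dot (G v - G u - mu *: (v - u)) (v - u).
Proof.
move=> mule hG hsc hL.
have key (a b w : 'cV[R]_n) :
    h a + dot (G a) (b + w - a) + mu / 2 * norm2 (b + w - a) ^+ 2 <=
    h b + dot (G b) w + ell / 2 * norm2 w ^+ 2.
  apply: le_trans (descent_lemma b w hG hL).
  by have := strongly_convex_tangent hsc (hG a (b + w - a)); lra.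
set k := _ - mu *: _.
(* In the sum of [key u v w] and [key v u (- w)] the values of [h] cancel. *)
have hw w : 0 <= dot k (v - u) + 2 * dot k w + (ell - mu) * norm2 w ^+ 2.
  have := key u v w; have := key v u (- w).
  have -> : v + w - u = (v - u) + w by rewrite addrAC.
  have -> : u - w - v = - ((v - u) + w) by rewrite opprD opprB addrAC.
  rewrite !norm2N !sqr_norm2D /k.
  rewrite !(dotE, sqr_norm2) (dotC v u); lra.
have hs s : 0 <= dot k (v - u) - 2 * s * norm2 k ^+ 2
    + (ell - mu) * s ^+ 2 * norm2 k ^+ 2.
  have := hw (- s *: k); rewrite dotZr norm2Z normrN exprMn real_normK ?num_real//.
  by rewrite -sqr_norm2; lra.
move: mule; rewrite -subr_ge0 le_eqVlt => /orP[/eqP e0|e0].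
  (* When [ell = mu] the bound [hs] is affine in [s], which forces [k = 0]. *)
  rewrite -e0 mul0r leNgt; apply/negP => k0.
  have := hs ((dot k (v - u) + 1) / (2 * norm2 k ^+ 2)).
  rewrite -e0 !mul0r addr0 mulrAC mulrA mulrC mulrA mulVf ?gt_eqF//; last first.
    by rewrite mulr_gt0.
  by lra.
have := hs (ell - mu)^-1.
have -> : (ell - mu) * (ell - mu)^-1 ^+ 2 = (ell - mu)^-1.
  by rewrite expr2 mulrA mulfV ?mul1r// gt_eqF.
move=> h1.
have : 0 <= dot k (v - u) - (ell - mu)^-1 * norm2 k ^+ 2 by lra.
by rewrite -(pmulr_rge0 _ e0) mulrBr mulrA mulfV ?gt_eqF// mul1r subr_ge0.
Qed.

(** With [r = z - p] and [k = G z - mu r], the step [2 / (ell + mu)] maps [r] to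
    [rho r - beta k] where [rho = (ell - mu) / (ell + mu)] and
    [beta (ell - mu) = 2 rho]; cocoercivity then makes the cross term
    [- 2 beta rho <k, r>] dominate [beta^2 |k|^2]. *)
Lemma gradient_step_contraction h G mu ell (z p : 'cV[R]_n) :
  0 < mu -> mu <= ell ->
  (forall z p, dir_deriv h z p (dot (G z) p)) ->
  strongly_convex mu h ->
  (forall z z', norm2 (G z - G z') <= ell * norm2 (z - z')) ->
  G p = 0 ->
  norm2 (z - (2 / (ell + mu)) *: G z - p) <=
    (ell - mu) / (ell + mu) * norm2 (z - p).
Proof.
move=> mu0 mule hG hsc hL Gp.
have := cocoercive_shift p z mule hG hsc hL; rewrite Gp subr0.
set r := z - p; set k := G z - mu *: r => hk.
have s0 : 0 < ell + mu by rewrite ltr_wpDl// (le_trans (ltW mu0)).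
have -> : z - (2 / (ell + mu)) *: G z - p =
    ((ell - mu) / (ell + mu)) *: r - (2 / (ell + mu)) *: k.
  rewrite /k [_ *: (G z - _)]scalerBr opprB addrA scalerA -scalerDl.
  have -> : (ell - mu) / (ell + mu) + 2 / (ell + mu) * mu = 1 by field; rewrite gt_eqF.
  by rewrite scale1r addrAC.
have q0 : 0 <= (ell - mu) / (ell + mu) by rewrite divr_ge0 ?subr_ge0// ltW.
rewrite -ler_sqr ?nnegrE ?norm2_ge0 ?(mulr_ge0 q0) ?norm2_ge0//.
rewrite sqr_norm2B !norm2Z !exprMn !real_normK ?num_real// dotZl dotZr (dotC r k).
have : (2 / (ell + mu)) ^+ 2 * norm2 k ^+ 2 <=
    (2 / (ell + mu)) ^+ 2 * ((ell - mu) * dot k r) by rewrite ler_wpM2l// sqr_ge0.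
have -> : (2 / (ell + mu)) ^+ 2 * ((ell - mu) * dot k r) =
   2 * ((ell - mu) / (ell + mu) * (2 / (ell + mu) * dot k r)).
  by rewrite !mulrA; field; rewrite gt_eqF.
by lra.
Qed.

Lemma strong_monotone h G mu (u v : 'cV[R]_n) :
  (forall z p, dir_deriv h z p (dot (G z) p)) ->
  strongly_convex mu h ->
  mu * norm2 (u - v) ^+ 2 <= dot (G u - G v) (u - v).
Proof.
move=> hG hsc.
have := strongly_convex_tangent hsc (hG u (v - u)).
have := strongly_convex_tangent hsc (hG v (u - v)).
by rewrite -(opprB u v) norm2N dotNr dotBl; lra.
Qed.

Lemma hessian_coercive h G mu (H : 'M[R]_n) (z v : 'cV[R]_n) :
  (forall z p, dir_deriv h z p (dot (G z) p)) ->
  strongly_convex mu h ->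
  frechet setT G z H ->
  mu * norm2 v ^+ 2 <= dot (H *m v) v.
Proof.
move=> hG hsc hH; apply/ler_addgt0Pr => e e0.
have e1 : 0 < e / (norm2 v ^+ 2 + 1) by rewrite divr_gt0// ltr_wpDl ?sqr_ge0.
have [d d0 hd] := hH _ e1.
have [s /andP[s0 s1] hs] := small_step d0 (norm2_ge0 v).
have := strong_monotone (z + s *: v) z hG hsc.
rewrite addrKl norm2Z gtr0_norm// dotZr.
have := hd (z + s *: v) I; rewrite addrKl norm2Z gtr0_norm//.
rewrite hs ?s0 ?lexx// => /(_ isT).
set Dg := G _ - G _ => h1.
have : dot (Dg - H *m (s *: v)) v <= e * s.
  rewrite (le_trans (dot_le _ _))//.
  rewrite (le_trans (ler_wpM2r (norm2_ge0 v) h1))//.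
  have -> : e / (norm2 v ^+ 2 + 1) * (s * norm2 v) * norm2 v =
      e / (norm2 v ^+ 2 + 1) * norm2 v ^+ 2 * s by ring.
  rewrite ler_pM2r// mulrAC ler_pdivrMr ?ltr_wpDl ?sqr_ge0//.
  by rewrite ler_pM2l// lerDl.
rewrite -scalemxAr dotBl dotZl => h2 h3.
rewrite -(ler_pM2l (mulr_gt0 s0 s0)).
have : s * dot Dg v <= s * (s * dot (H *m v) v + e * s) by rewrite ler_pM2l//; lra.
lra.
Qed.

(** The second difference of [h] along [s u] and [s v] is, by the mean value
    theorem, [s] times an increment of [G], hence [s^2 <H u, v>] up to
    [o(s^2)]; it does not change when [u] and [v] are exchanged. *)
Lemma hessian_sym h G (H : 'M[R]_n) (z : 'cV[R]_n) :
  (forall z p, dir_deriv h z p (dot (G z) p)) ->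
  frechet setT G z H ->
  H^T = H.
Proof.
move=> hG hH.
pose Delta (s : R) (u v : 'cV[R]_n) :=
  h (z + s *: v + s *: u) - h (z + s *: v) - (h (z + s *: u) - h z).
have hDelta u v e : 0 < e -> exists2 s0, 0 < s0 & forall s, 0 < s <= s0 ->
    `|Delta s u v - s ^+ 2 * dot (H *m u) v| <= e * s ^+ 2.
  move=> e0; set c := 2 * (norm2 u + norm2 v) * norm2 v + 1.
  have nuv : 0 <= norm2 u + norm2 v by rewrite addr_ge0 ?norm2_ge0.
  have c0 : 0 < c by rewrite ltr_wpDl// !mulr_ge0 ?norm2_ge0.
  have e1 : 0 < e / c by rewrite divr_gt0.
  have [d d0 hd] := hH _ e1.
  have [s0 /andP[s00 s01] hs0] := small_step d0 nuv.
  exists s0 => // s /andP[sp ss].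
  have dG x p : dir_deriv (fun x => h (x + s *: u) - h x) x p
      (dot (G (x + s *: u) - G x) p).
    move=> e' e'0; have e2 : 0 < e' / 2 by rewrite divr_gt0.
    have [a a0 ha] := hG (x + s *: u) p _ e2.
    have [b b0 hb] := hG x p _ e2.
    exists (Num.min a b) => [|r]; first by rewrite lt_min a0 b0.
    rewrite le_min => /and3P[r0 ra rb].
    have := ha r; rewrite r0 => /(_ ra) {}ha.
    have := hb r; rewrite r0 => /(_ rb) {}hb.
    rewrite (_ : x + r *: p + s *: u = x + s *: u + r *: p); last by rewrite addrAC.
    rewrite dotBl [e']splitr mulrDl.
    apply: le_trans (lerD ha hb); apply: le_trans (ler_normB _ _).
    by rewrite le_eqVlt; apply/orP; left; apply/eqP; congr (`|_|); ring.
  have [|th /andP[th0 th1]] := @dir_deriv_mvt _ _ _ _ z (s *: v) (dG^~ (s *: v)).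
    by move=> x; rewrite -dotNr.
  rewrite /Delta => ->.
  set p := th *: (s *: v).
  have np : norm2 p <= s * norm2 v.
    rewrite /p norm2Z norm2Z (ger0_norm th0) (gtr0_norm sp) ler_piMl//.
    by rewrite mulr_ge0 ?norm2_ge0// ltW.
  clearbody p.
  have np2 : norm2 p <= s * (norm2 u + norm2 v).
    by rewrite (le_trans np)// ler_pM2l// lerDr norm2_ge0.
  have npu : norm2 (p + s *: u) <= s * (norm2 u + norm2 v).
    rewrite (le_trans (norm2D _ _))// (norm2Z s u) (gtr0_norm sp) mulrDr addrC.
    by rewrite lerD2l.
  have sd : s * (norm2 u + norm2 v) < d by rewrite hs0// sp.
  have := hd (z + (p + s *: u)) I; rewrite addrKl => /(_ (le_lt_trans npu sd)).
  set A1 := _ - H *m _ => hA1.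
  have := hd (z + p) I; rewrite addrKl => /(_ (le_lt_trans np2 sd)).
  set A2 := _ - H *m _ => hA2.
  have -> : dot (G (z + p + s *: u) - G (z + p)) (s *: v) - s ^+ 2 * dot (H *m u) v =
      s * dot (A1 - A2) v.
    by rewrite /A1 /A2 -(addrA z p) mulmxDr -scalemxAr !dotE; ring.
  have hA : norm2 (A1 - A2) <= e / c * (2 * (s * (norm2 u + norm2 v))).
    rewrite (le_trans (norm2B _ _))// mulrC -mulrA mulrC mulr_natr mulr2n mulrC.
    apply: lerD; [apply: le_trans hA1 _|apply: le_trans hA2 _];
      by rewrite ler_pM2l.
  rewrite normrM (gtr0_norm sp) expr2 mulrA [e * s]mulrC -mulrA ler_pM2l//.
  rewrite (le_trans (cauchy_schwarz _ _))//.
  rewrite (le_trans (ler_wpM2r (norm2_ge0 v) hA))//.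
  have -> : e / c * (2 * (s * (norm2 u + norm2 v))) * norm2 v = e / c * (c - 1) * s.
    by rewrite /c; ring.
  by rewrite ler_pM2r// mulrAC ler_pdivrMr// ler_pM2l// gerBl.
have sym_le u' v : dot (H *m u') v <= dot (H *m v) u'.
  apply/ler_addgt0Pr => e e0; have e2 : 0 < e / 2 by rewrite divr_gt0.
  have [a a0 ha] := hDelta u' v _ e2; have [b b0 hb] := hDelta v u' _ e2.
  have s0 : 0 < Num.min a b by rewrite lt_min a0 b0.
  have := ha (Num.min a b); rewrite s0 ge_min lexx => /(_ isT).
  have := hb (Num.min a b); rewrite s0 ge_min lexx orbT => /(_ isT).
  have -> : Delta (Num.min a b) v u' = Delta (Num.min a b) u' v.
    by rewrite /Delta (addrAC z); ring.
  set s := Num.min a b; rewrite !ler_norml => /andP[h1 h2] /andP[h3 h4].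
  have ss : 0 < s ^+ 2 by rewrite exprn_gt0.
  by rewrite -(ler_pM2l ss); lra.
suff HT (u0 : 'cV[R]_n) : H^T *m u0 = H *m u0.
  apply/matrixP => i j; have := HT (delta_mx j 0).
  by rewrite -!colE => /matrixP/(_ i 0); rewrite !mxE.
apply/eqP; rewrite -subr_eq0; apply/eqP/norm2_eq0/eqP.
rewrite -sqrf_eq0 sqr_norm2; set x := H^T *m u0 - H *m u0.
have -> : dot x x = dot (H^T *m u0) x - dot (H *m u0) x by rewrite -dotBl.
by rewrite dot_mulmxl trmxK [dot u0 _]dotC subr_eq0; apply/eqP/le_anti; rewrite !sym_le.
Qed.

End SmoothFunctions.

(** * Projected gradient steps on a convex set *)

Section ProjectedGradient.
Context {R : realType} {n : nat} (X : set 'cV[R]_n).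
Context (X_segment : forall a b s, X a -> X b -> 0 <= s <= 1 -> X (a + s *: (b - a))).

Lemma projection_variational (v q p : 'cV[R]_n) :
  is_projection X v q -> X p -> dot (v - q) (p - q) <= 0.
Proof.
move=> [Xq qmin] Xp; apply/ler_addgt0Pr => e e0.
have [s /andP[s0 s1] hs] := small_step e0 (sqr_ge0 (norm2 (p - q))).
have s01 : 0 <= s <= 1 by rewrite ltW.
have := qmin _ (X_segment Xq Xp s01).
rewrite /= -ler_sqr ?nnegrE ?norm2_ge0// opprD addrA.
rewrite [leRHS]sqr_norm2B norm2Z exprMn.
rewrite real_normK ?num_real// dotZr.
have := hs s; rewrite s0 lexx => /(_ isT) h1 h2.
have e2 : s * (s * norm2 (p - q) ^+ 2) < s * e by rewrite ltr_pM2l.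
by rewrite -(ler_pM2l s0); have := mulr_gt0 s0 e0; lra.
Qed.

Context (F : 'cV[R]_n -> R) (dF : 'cV[R]_n -> 'cV[R]_n) (L : R) (L_ge0 : 0 <= L).
Context (F_deriv : forall u v, X u -> X v -> dir_deriv F u (v - u) (dot (dF u) (v - u))).
Context (F_convex : forall a b s, X a -> X b -> 0 <= s <= 1 ->
  F (a + s *: (b - a)) <= (1 - s) * F a + s * F b).
Context (dF_lip : forall u v a b, X u -> X v -> X a -> X b ->
  dot (dF u - dF v) (a - b) <= L * norm2 (u - v) * norm2 (a - b)).

Lemma convex_tangent u v : X u -> X v -> dot (dF u) (v - u) <= F v - F u.
Proof.
move=> Xu Xv; rewrite -[X in X <= _]addr0 -{2}[v](subrKC u).
apply: dir_deriv_chord (F_deriv Xu Xv) => s s01.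
by rewrite !mul0r subr0 (subrKC u); apply: F_convex.
Qed.

Context (p : 'cV[R]_n) (Xp : X p) (dFp : forall u, X u -> dot (dF p) (u - p) = 0).

(** The comparison of [F] at [u = p + t/2 (x - p)] and at [v + t (x' - x)], where
    [v = p + t (x - p)]: the latter is [p + t (x' - p)], hence in [X]. *)
Let halving x x' t : X x -> X x' -> 0 < t <= 1 ->
  - dot (dF (p + t *: (x - p)) - dF (p + (t / 2) *: (x - p))) (x' - x) <=
  2^-1 * dot (dF (p + t *: (x - p)) - dF (p + (t / 2) *: (x - p))) (x - p)
  + L * t * norm2 (x' - x) ^+ 2.
Proof.
move=> Xx Xx' /andP[t0 t1].
set u := p + (t / 2) *: _; set v := p + t *: _; set w := x' - x; set a := x - p.
have Xu : X u by apply: X_segment => //; lra.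
have Xv : X v by apply: X_segment => //; lra.
have evw : v + t *: w = p + t *: (x' - p).
  by rewrite /v /w -addrA -scalerDr [x - p + _]addrC subrKA.
have Xvw : X (v + t *: w) by rewrite evw; apply: X_segment => //; lra.
have evu : v - u = (t / 2) *: a.
  rewrite /v /u opprD addrACA subrr add0r -scalerBl; congr (_ *: _); lra.
have h1 := convex_tangent Xu Xvw.
have h2 := convex_tangent Xvw Xv.
have h3 := convex_tangent Xv Xu.
have h4 := dF_lip Xvw Xv Xx' Xx.
rewrite addrAC evu dotDr !dotZr in h1.
rewrite opprD addrA subrr sub0r dotNr dotZr in h2.
rewrite -(opprB v u) dotNr evu dotZr in h3.
rewrite addrKl norm2Z gtr0_norm// -/w dotBl in h4.
have h5 : t * (dot (dF (v + t *: w)) w - dot (dF v) w) <= t * (L * t * norm2 w ^+ 2).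
  by rewrite ler_pM2l// expr2 mulrA -[L * t * _]mulrA.
move: h1 h2 h3 h5; clearbody w a; rewrite !dotBl => h1 h2 h3 h5.
by rewrite -(ler_pM2l t0); lra.
Qed.

Let chain x x' k : X x -> X x' ->
  - dot (dF x - dF (p + 2^-1 ^+ k *: (x - p))) (x' - x) <=
  2^-1 * dot (dF x - dF (p + 2^-1 ^+ k *: (x - p))) (x - p)
  + 2 * L * (1 - 2^-1 ^+ k) * norm2 (x' - x) ^+ 2.
Proof.
move=> Xx Xx'; elim: k => [|k IH].
  by rewrite expr0 scale1r subrKC !subrr !dot0l oppr0 !(mulr0, mul0r) addr0.
have t01 : 0 < (2^-1 : R) ^+ k <= 1.
  by rewrite exprn_gt0 ?invr_gt0// exprn_ile1// ?invr_ge0// invf_le1// ler1n.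
have := halving Xx Xx' t01; rewrite [2^-1 ^+ k.+1]exprSr.
move: IH; rewrite !dotBl; move: (2^-1 ^+ k) => t h1 h2; lra.
Qed.

(** For a convex, [L]-smooth function on the whole space this would follow from
    the self-bounding property of smooth functions.  Constrained to [X] one can
    only move from a point of the segment [[p, x]] towards [x'] by
    a step proportional to the distance to [p]; the geometric chain
    [p + 2^-k (x - p)] makes the available steps commensurate with the
    distances between its consecutive points. *)
Lemma constrained_self_bounding x x' : X x -> X x' ->
  - dot (dF x) (x' - x) <= 2^-1 * dot (dF x) (x - p) + 2 * L * norm2 (x' - x) ^+ 2.
Proof.
move=> Xx Xx'; apply/ler_addgt0Pr => e e0.
set c := L * norm2 (x - p) * (norm2 (x - p) + norm2 (x' - x)).
have c0 : 0 <= c by rewrite !mulr_ge0 ?addr_ge0 ?norm2_ge0.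
set k := Num.bound (c / e).
have hk : c * 2^-1 ^+ k <= e.
  have := archi_boundP (divr_ge0 c0 (ltW e0)); rewrite -/k => h.
  have : c / e <= 2 ^+ k.
    by rewrite (le_trans (ltW h))// -natrX ler_nat ltnW// ltn_expl.
  by rewrite ler_pdivrMr// mulrC exprVn ler_pdivrMr ?exprn_gt0// mulrC.
have t01 : 0 < (2^-1 : R) ^+ k <= 1.
  by rewrite exprn_gt0 ?invr_gt0// exprn_ile1// ?invr_ge0// invf_le1// ler1n.
have /andP[t0 t1] := t01.
have := chain k Xx Xx'; move: hk t0 t1; set t := 2^-1 ^+ k => hk t0 t1.
set u := p + t *: (x - p).
have Xu : X u by apply: X_segment => //; rewrite ltW.
have h1 := dF_lip Xu Xp Xp Xx; have h2 := dF_lip Xu Xp Xx Xx'.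
have e1 : dot (dF p) (p - x) = 0 by rewrite -opprB dotNr dFp// oppr0.
have e2 : dot (dF p) (x - x') = 0.
  by rewrite -(subrKA p x) dotDr dFp// -opprB dotNr dFp// oppr0 addr0.
move: h1; rewrite dotBl e1 subr0 /u addrKl norm2Z gtr0_norm// -/u.
rewrite (norm2_distC p) -(opprB x p) dotNr => h1.
move: h2; rewrite dotBl e2 subr0 /u addrKl norm2Z gtr0_norm// -/u.
rewrite (norm2_distC x x') -(opprB x' x) dotNr => h2.
rewrite !dotBl => h3.
have h4 : 0 <= 2 * L * t * norm2 (x' - x) ^+ 2.
  by rewrite !mulr_ge0 ?sqr_ge0 ?norm2_ge0// ltW.
have h5 : 0 <= L * (t * norm2 (x - p)) * norm2 (x - p).
  by rewrite !mulr_ge0 ?norm2_ge0// ltW.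
have : c * t = L * (t * norm2 (x - p)) * norm2 (x - p)
   + L * (t * norm2 (x - p)) * norm2 (x' - x) by rewrite /c; ring.
move: h1 h2 h3 h4 h5 hk; clearbody u t c; clear.
move: (dot (dF u) _) (dot (dF u) _) (dot (dF x) _) (dot (dF x) _) => d1 d2 d3 d4. 
lra.
Qed.

(** The linearised gap [<dF x, x - p>] bounds the gap, and one half of it comes
    back from [constrained_self_bounding]; the square of the step is absorbed by
    the negative square in the variational inequality as [4 alpha L <= 1]. *)
Lemma projected_step_gap (alpha E : R) (h x x' : 'cV[R]_n) :
  0 < alpha -> alpha * (4 * L) <= 1 -> X x ->
  is_projection X (x - alpha *: h) x' ->
  dot (dF x - h) (x' - p) <= E ->
  F x - F p <= alpha^-1 * (norm2 (x - p) ^+ 2 - norm2 (x' - p) ^+ 2) + 2 * E.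
Proof.
move=> al0 alL Xx pr hE; have Xx' := pr.1.
have := projection_variational pr Xp.
have e1 : x - p = (x' - p) - (x' - x) by rewrite opprB [RHS]addrC subrKA.
have e2 : norm2 (x - p) ^+ 2 =
    norm2 (x' - p) ^+ 2 - 2 * dot (x' - x) (x' - p) + norm2 (x' - x) ^+ 2.
  by rewrite e1 sqr_norm2B (dotC (x' - p)).
have e3 : dot (dF x) (x - p) = dot (dF x) (x' - p) - dot (dF x) (x' - x).
  by rewrite e1 dotBr.
have hs := constrained_self_bounding Xx Xx'.
have ht := convex_tangent Xx Xp.
have -> : x - alpha *: h - x' = - ((x' - x) + alpha *: h) by rewrite opprD opprB addrAC.
rewrite -(opprB x' p) dotNl dotNr opprK dotDl dotZl => hp.
rewrite -(opprB x p) dotNr in ht.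
have hL : 2 * L * norm2 (x' - x) ^+ 2 <= alpha^-1 * 2^-1 * norm2 (x' - x) ^+ 2.
  by rewrite ler_wpM2r ?sqr_ge0// ler_pdivlMl//; lra.
have hp' : dot h (x' - p) <= - (alpha^-1 * dot (x' - x) (x' - p)).
  by rewrite -mulrN ler_pdivlMl//; lra.
rewrite dotBl in hE; rewrite e3 in hs ht; rewrite e2.
move: hp' hL; move: (alpha^-1) => r hp' hL; lra.
Qed.

End ProjectedGradient.

(** * Rates and summation *)

Section Rates.
Context {R : realType}.

(** The rate [(2 t)^-(1 + u / 4)]; here [1 - u] is the contraction factor of one
    inner step, that is [u = 2 / (kappa + 1)]. *)
Definition inner_rate (u : R) (t : nat) : R := expR (- ((1 + u / 4) * ln (2 * t%:R))).

Lemma ln_2n_ge (t : nat) : (0 < t)%N -> ln (t%:R : R) <= ln (2 * t%:R).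
Proof.
move=> t0; have t1 : 0 < t%:R :> R by rewrite ltr0n.
by rewrite ler_ln ?posrE ?mulr_gt0// ler_peMl ?ler1n// ltW.
Qed.

Lemma inner_rate_half u t : 0 <= u -> (0 < t)%N -> inner_rate u t <= 2^-1.
Proof.
move=> u0 t0; have t1 : 1 <= t%:R :> R by rewrite ler1n.
have l0 : ln 2 <= ln (2 * t%:R : R).
  by rewrite ler_ln ?posrE ?mulr_gt0// ?ler_peMr// (lt_le_trans ltr01).
have l1 : 0 <= ln (2 : R) by rewrite ln_ge0// ler1n.
rewrite -[leRHS]lnK ?posrE ?invr_gt0// lnV ?posrE// ler_expR lerN2.
by rewrite (le_trans l0)// ler_peMl ?(le_trans l1)// lerDl divr_ge0.
Qed.

(** The elementary bound [(1 - u) ^ K <= exp (- u K)] only gives the rate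
    [1 / (2 t)], whose sum diverges; the second-order gain [u / 4] in the exponent
    makes it summable. *)
Lemma contraction_le_inner_rate u K t : 0 < u <= 1 -> (0 < t)%N ->
  ln (2 * t%:R) <= K%:R * u -> (1 - u) ^+ K <= inner_rate u t.
Proof.
move=> /andP[u0 u1] t0 hK.
(* [1 - u <= (1 - u / 2)^2 (1 - u^2 / 4)] *)
have h1 : 1 - u <= expR (- (u * (1 + u / 4))).
  have e1 : 1 - u / 2 <= expR (- (u / 2)) by have := expR_ge1Dx (- (u / 2)); lra.
  have e2 : 1 - u ^+ 2 / 4 <= expR (- (u ^+ 2 / 4)).
    by have := expR_ge1Dx (- (u ^+ 2 / 4)); lra.
  have -> : - (u * (1 + u / 4)) = - (u / 2) + - (u / 2) + - (u ^+ 2 / 4) by field.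
  rewrite 2!expRD; apply: (@le_trans _ _ ((1 - u / 2) * (1 - u / 2) * (1 - u ^+ 2 / 4))).
    have : 0 <= u ^+ 2 / 4 * (u - u ^+ 2 / 4) by nra.
    by lra.
  have u2 : 0 <= 1 - u / 2 by lra.
  have u4 : 0 <= 1 - u ^+ 2 / 4 by nra.
  by rewrite ler_pM ?mulr_ge0// ler_pM.
apply: (@le_trans _ _ (expR (- (u * (1 + u / 4))) ^+ K)).
  by rewrite lerXn2r ?nnegrE ?expR_ge0// subr_ge0.
rewrite -expRM_natr ler_expR mulNr lerN2.
have -> : u * (1 + u / 4) * K%:R = (1 + u / 4) * (K%:R * u) by ring.
by rewrite ler_pM2l//; lra.
Qed.

(** Telescoping, with [e = u / 4]: [e t^-(1 + e) <= (t - 1)^-e - t^-e]. *)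
Lemma inner_rate_sum u T : 0 < u ->
  \sum_(1 <= t < T.+1) inner_rate u t <= 1 + 4 / u.
Proof.
move=> u0; set e := u / 4; have e0 : 0 < e by rewrite divr_gt0.
have -> : 4 / u = e^-1 by rewrite /e invf_div.
pose b (t : nat) : R := expR (- (e * ln t%:R)).
suff h k : \sum_(1 <= t < k.+2) inner_rate u t <= 1 + e^-1 * (1 - b k.+1).
  case: T => [|T]; first by rewrite big_geq// addr_ge0// invr_ge0 ltW.
  apply: le_trans (h T) _; rewrite lerD2l ler_piMr ?invr_ge0 ?(ltW e0)//.
  by rewrite gerBl expR_ge0.
elim: k => [|k IH].
  rewrite big_nat1 /b ln1 mulr0 oppr0 expR0 subrr mulr0 addr0.
  by rewrite (le_trans (inner_rate_half (ltW u0) _))// invf_le1// ler1n.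
rewrite big_nat_recr//=; apply: le_trans (lerD IH (lexx _)) _.
suff : e * inner_rate u k.+2 <= b k.+1 - b k.+2.
  by rewrite -ler_pdivlMl// mulrBr; lra.
have k2 : 0 < k.+2%:R :> R by rewrite ltr0n.
have k1 : 0 < k.+1%:R :> R by rewrite ltr0n.
have h1 : inner_rate u k.+2 <= b k.+2 * (k.+2%:R)^-1.
  rewrite -[X in _ * X]lnK ?posrE ?invr_gt0// lnV ?posrE// -expRD ler_expR.
  rewrite -opprD lerN2 /inner_rate -/e.
  have l0 : 0 <= ln (k.+2%:R : R) by rewrite ln_ge0// ler1n.
  have e1 : 0 < 1 + e by rewrite addr_gt0.
  have hl : (1 + e) * ln k.+2%:R <= (1 + e) * ln (2 * k.+2%:R : R).
    by rewrite ler_pM2l// ln_2n_ge.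
  by apply: le_trans hl; lra.
have h2 : b k.+2 * (1 + e / k.+2%:R) <= b k.+1.
  have -> : b k.+1 = b k.+2 * expR (e * (ln k.+2%:R - ln k.+1%:R)).
    by rewrite -expRD; congr expR; ring.
  rewrite ler_pM2l ?expR_gt0// (le_trans _ (expR_ge1Dx _))// lerD2l ler_pM2l//.
  have := @le_ln1Dx R (k.+1%:R / k.+2%:R - 1).
  rewrite subrKC lnM ?posrE ?invr_gt0// lnV ?posrE// => hl.
  have : k.+1%:R / k.+2%:R - 1 = - (k.+2%:R)^-1 :> R.
    have -> : k.+1%:R = k.+2%:R - 1 :> R by rewrite -[in RHS]natr1 addrK.
    by rewrite mulrBl mulfV ?gt_eqF// mul1r addrAC subrr add0r.
  have : -1 < k.+1%:R / k.+2%:R - 1 :> R by rewrite ltrBrDl subrr divr_gt0.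
  by move=> /hl {}hl hk; rewrite hk in hl; rewrite -lerN2 opprB.
have h3 : e * inner_rate u k.+2 <= e * (b k.+2 / k.+2%:R) by rewrite ler_pM2l.
move: h2 h3; move: (k.+2%:R^-1) => r h2 h3; lra.
Qed.

(** The part [z] of the error in excess of the steady level [B = D' + 2 c] is
    halved at each round, so it sums up to the total drift [\sum Y_t]. *)
Lemma tracking_error_sum (delta q Y : nat -> R) (D' c : R) (T : nat) :
  0 <= c ->
  (forall t, (1 <= t <= T)%N -> 0 <= q t <= 2^-1) ->
  (forall t, 0 <= delta t) -> (forall t, 0 <= Y t) -> delta 1%N <= D' ->
  (forall t, (1 <= t < T)%N -> delta t.+1 <= q t * delta t + c + Y t.+1) ->
  \sum_(1 <= t < T.+1) q t * delta t <=
    (D' + 2 * c) * (\sum_(1 <= t < T.+1) q t) + \sum_(2 <= t < T.+1) Y t.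
Proof.
move=> c0 hq d0 Y0 d1 hd; set B := D' + 2 * c.
have D0 : 0 <= D' := le_trans (d0 1%N) d1.
suff h k : (k < T)%N -> exists z, [/\ 0 <= z, delta k.+1 <= B + z &
    \sum_(1 <= t < k.+1) q t * delta t + z <=
    B * (\sum_(1 <= t < k.+1) q t) + \sum_(2 <= t < k.+2) Y t].
  case: T hq hd h => [|T] hq hd h.
    by rewrite !big_geq// mulr0 addr0.
  have [z [z0 dz hz]] := h T (ltnSn T).
  rewrite [X in X <= _]big_nat_recr//= [X in B * X]big_nat_recr//=.
  have /andP[q0 q1] := hq T.+1 (ltnSn _ : (1 <= T.+1 <= T.+1)%N).
  have : q T.+1 * delta T.+1 <= q T.+1 * (B + z) by rewrite ler_wpM2l.
  have : q T.+1 * z <= z by rewrite ler_piMl//; lra.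
  lra.
elim: k => [|k IH] kT.
  exists 0; rewrite !big_geq//; split=> //; last by rewrite mulr0 !addr0.
  by rewrite addr0 (le_trans d1)// lerDl mulr_ge0.
have [z [z0 dz hz]] := IH (ltnW kT).
have hk : (1 <= k.+1 < T)%N by [].
have /andP[q0 q1] := hq k.+1 (ltnW kT : (1 <= k.+1 <= T)%N).
have h4 := hd _ hk.
have h1 : q k.+1 * delta k.+1 <= q k.+1 * (B + z) by rewrite ler_wpM2l.
have h2 : q k.+1 * z <= 2^-1 * z by rewrite ler_wpM2r.
have h3 : q k.+1 * B <= 2^-1 * B by rewrite ler_wpM2r// addr_ge0// mulr_ge0.
have h5 : 2^-1 * B + c <= B by rewrite /B; lra.
have Yk := Y0 k.+2; clearbody B.
exists (z / 2 + Y k.+2); split.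
- by rewrite addr_ge0// divr_ge0.
- by lra.
rewrite [X in X + _ <= _]big_nat_recr//= [X in B * X]big_nat_recr//=.
rewrite [X in _ <= _ + X]big_nat_recr//=; lra.
Qed.

(** [A t] and [B t] are the distances to the comparator of round [t] before and
    after the update; a change of comparator costs [2 D] times its length. *)
Lemma drifting_telescope (A B P : nat -> R) (D : R) (T : nat) :
  (forall t, (1 <= t <= T)%N -> 0 <= A t <= D) ->
  (forall t, (1 <= t <= T)%N -> 0 <= B t <= D) ->
  (forall t, 0 <= P t) ->
  (forall t, (1 <= t < T)%N -> A t.+1 <= B t + P t.+1) ->
  \sum_(1 <= t < T.+1) (A t ^+ 2 - B t ^+ 2) <=
    D ^+ 2 + 2 * D * (\sum_(2 <= t < T.+1) P t).
Proof.
move=> hA hB P0 hP.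
suff h k : (k < T)%N -> \sum_(1 <= t < k.+2) (A t ^+ 2 - B t ^+ 2) <=
    D ^+ 2 + 2 * D * (\sum_(2 <= t < k.+2) P t) - B k.+1 ^+ 2.
  case: T h {hA hB hP} => [|T] h; first by rewrite !big_geq// mulr0 addr0 sqr_ge0.
  by rewrite (le_trans (h T (ltnSn T)))// gerBl sqr_ge0.
elim: k => [|k IH] kT.
  rewrite big_nat1 big_geq// mulr0 addr0 lerD2r.
  have /andP[a0 aD] := hA 1%N kT.
  by rewrite ler_sqr ?nnegrE// (le_trans a0).
rewrite big_nat_recr//= [X in _ * X]big_nat_recr//=.
have := IH (ltnW kT).
have /andP[a0 aD] := hA k.+2 kT.
have /andP[b0 bD] := hB k.+1 (ltnW kT).
have hab := hP k.+1 kT; have p0 := P0 k.+2.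
suff : A k.+2 ^+ 2 - B k.+1 ^+ 2 <= 2 * D * P k.+2 by lra.
rewrite subr_sqr; case: (lerP (A k.+2) (B k.+1)) => ab.
  apply: (@le_trans _ _ 0); last by rewrite !mulr_ge0// (le_trans a0).
  by rewrite mulr_le0_ge0 ?subr_le0 ?addr_ge0.
by rewrite mulrC ler_pM ?(addr_ge0 a0 b0) ?subr_ge0 ?(ltW ab)//; lra.
Qed.

End Rates.

(** * The hypergradient *)

Section Hypergradient.
Context {R : realType} {d1 d2 : nat} (X : set 'cV[R]_d1).
Context (f g : 'cV[R]_(d1 + d2) -> R).
Context (gradf gradg : 'cV[R]_(d1 + d2) -> 'cV[R]_(d1 + d2)).
Context (hessg : 'cV[R]_(d1 + d2) -> 'M[R]_(d1 + d2)).
Context (M : 'cV[R]_d1 -> 'cV[R]_d2 -> 'M[R]_(d1, d2)).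
Context (ystar : 'cV[R]_d1 -> 'cV[R]_d2).
Context (lf0 lf1 lg1 lg2 mu : R).
Local Notation Z := (cylinder (d2 := d2) X).
Context (lf0_ge0 : 0 <= lf0) (lf1_ge0 : 0 <= lf1) (lg1_ge0 : 0 <= lg1)
  (lg2_ge0 : 0 <= lg2) (mu_gt0 : 0 < mu).
Context (X_segment : forall a b s, X a -> X b -> 0 <= s <= 1 -> X (a + s *: (b - a))).
Context (f_grad : forall z, Z z -> has_gradient_within Z f z (gradf z)).
Context (g_grad : forall z, Z z -> has_gradient_within Z g z (gradg z)).
Context (g_hess : forall z, Z z -> has_jacobian_within Z gradg z (hessg z)).
Context (f_lip : forall z z', Z z -> Z z' -> `|f z - f z'| <= lf0 * norm2 (z - z')).
Context (g_strong : forall u, X u -> strongly_convex mu (fun v => g (col_mx u v))).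
Context (gradf_lip : forall z z', Z z -> Z z' ->
  norm2 (gradf z - gradf z') <= lf1 * norm2 (z - z')).
Context (gradg_lip : forall z z', Z z -> Z z' ->
  norm2 (gradg z - gradg z') <= lg1 * norm2 (z - z')).
Context (hessg_lip : forall z z', Z z -> Z z' ->
  opnorm (hessg z - hessg z') <= lg2 * norm2 (z - z')).
Context (ystar_min : forall u, X u -> is_argmin setT (fun v => g (col_mx u v)) (ystar u)).
Context (M_solves : forall u v, X u -> M u v *m hess_yy hessg u v + hess_xy hessg u v = 0).

Let Zcol u v : X u -> Z (col_mx u v).
Proof. by rewrite /cylinder /= col_mxKu. Qed.

Let dsubmxB (z z' : 'cV[R]_(d1 + d2)) : dsubmx (z - z') = dsubmx z - dsubmx z'.
Proof. exact: linearB. Qed.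

Let usubmxB (z z' : 'cV[R]_(d1 + d2)) : usubmx (z - z') = usubmx z - usubmx z'.
Proof. exact: linearB. Qed.

Lemma dir_deriv_slice (F : 'cV[R]_(d1 + d2) -> R) (G : 'cV[R]_(d1 + d2)) u v p :
  X u -> has_gradient_within Z F (col_mx u v) G ->
  dir_deriv (fun q => F (col_mx u q)) v p (dot (dsubmx G) p).
Proof.
move=> Xu FG.
have : dir_deriv F (col_mx u v) (col_mx 0 p) (dot G (col_mx 0 p)).
  apply: gradient_dir_deriv FG => s _.
  by rewrite scale_col_mx scaler0 add_col_mx addr0; apply: Zcol.
rewrite -{1}[G]vsubmxK dot_col_mx dot0r add0r => h e /h[a a0 ha].
exists a => // s /ha.
by rewrite scale_col_mx scaler0 add_col_mx addr0.
Qed.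

Lemma g_slice_deriv u v p : X u ->
  dir_deriv (fun q => g (col_mx u q)) v p (dot (grad_y gradg u v) p).
Proof. by move=> Xu; apply: dir_deriv_slice => //; apply/g_grad/Zcol. Qed.

Lemma dsubmx_mul_col (H : 'M[R]_(d1 + d2)) (a : 'cV[R]_d1) (b : 'cV[R]_d2) :
  dsubmx (H *m col_mx a b) = dlsubmx H *m a + drsubmx H *m b.
Proof. by rewrite -{1}[H]submxK mul_block_col col_mxKd. Qed.

Lemma grad_y_slice_frechet u v : X u ->
  frechet setT (grad_y gradg u) v (hess_yy hessg u v).
Proof.
move=> Xu e e0; have [d d0 hd] := jacobian_frechet (g_hess (Zcol v Xu)) e0.
exists d => // v' _ v'd.
have e1 : col_mx u v' - col_mx u v = col_mx 0 (v' - v).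
  by rewrite opp_col_mx add_col_mx subrr.
have := hd _ (Zcol v' Xu); rewrite e1 norm2_col_0mx => /(_ v'd).
apply: le_trans; apply: le_trans (norm2_dsubmx _).
by rewrite !dsubmxB dsubmx_mul_col mulmx0 add0r.
Qed.

Lemma grad_y_ystar u : X u -> grad_y gradg u (ystar u) = 0.
Proof.
move=> Xu; have [_ umin] := ystar_min Xu.
have := dir_deriv_min (fun v => umin v I) (g_slice_deriv (ystar u) (- grad_y gradg u (ystar u)) Xu).
rewrite dotNr oppr_ge0 -sqr_norm2 => h; apply/norm2_eq0/eqP.
by rewrite -sqrf_eq0 eq_le h sqr_ge0.
Qed.

Lemma hess_yy_lower u v p : X u -> mu * norm2 p <= norm2 (hess_yy hessg u v *m p).
Proof.
move=> Xu.
have := hessian_coercive p (fun z q => g_slice_deriv z q Xu) (g_strong Xu)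
  (grad_y_slice_frechet v Xu).
have [->|/norm2_gt0 p0] := eqVneq p 0; first by rewrite norm2_0 mulr0 norm2_ge0.
by move=> /le_trans /(_ (dot_le _ _)); rewrite expr2 mulrA ler_pM2r.
Qed.

(** Strong monotonicity in [y] at fixed [u], tested on the two minimisers. *)
Lemma ystar_lip u u' : X u -> X u' ->
  norm2 (ystar u - ystar u') <= lg1 / mu * norm2 (u - u').
Proof.
move=> Xu Xu'.
have := strong_monotone (ystar u) (ystar u') (fun z q => g_slice_deriv z q Xu) (g_strong Xu).
rewrite grad_y_ystar// -(grad_y_ystar Xu').
have : norm2 (grad_y gradg u' (ystar u') - grad_y gradg u (ystar u')) <= lg1 * norm2 (u - u').
  rewrite /grad_y -dsubmxB (le_trans (norm2_dsubmx _))//.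
  rewrite (le_trans (gradg_lip (Zcol _ Xu') (Zcol _ Xu)))//.
  by rewrite opp_col_mx add_col_mx subrr norm2_col_mx0 norm2_distC.
have [->|] := eqVneq (ystar u - ystar u') 0.
  by rewrite norm2_0 => _ _; rewrite mulr_ge0 ?norm2_ge0// divr_ge0// ltW.
move=> /norm2_gt0 p0 h1 /le_trans /(_ (dot_le _ _)).
rewrite expr2 mulrA ler_pM2r// => /le_trans /(_ h1).
by rewrite -ler_pdivlMl// mulrA [_^-1 * _]mulrC.
Qed.

Lemma mu_le_lg1 u (v : 'cV[R]_d2) : X u -> v != 0 -> mu <= lg1.
Proof.
move=> Xu /norm2_gt0 v0.
have := strong_monotone v 0 (fun z q => g_slice_deriv z q Xu) (g_strong Xu).
have : norm2 (grad_y gradg u v - grad_y gradg u 0) <= lg1 * norm2 v.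
  rewrite /grad_y -dsubmxB (le_trans (norm2_dsubmx _))//.
  rewrite (le_trans (gradg_lip (Zcol _ Xu) (Zcol _ Xu)))//.
  by rewrite opp_col_mx add_col_mx subrr subr0 norm2_col_0mx.
rewrite subr0 => h1 h2.
have := le_trans h2 (le_trans (dot_le _ _) (ler_wpM2r (norm2_ge0 v) h1)).
by rewrite expr2 mulrA !ler_pM2r.
Qed.

Lemma inner_loop_contraction u z K : X u -> mu <= lg1 ->
  norm2 (iter K (fun q => q - (2 / (lg1 + mu)) *: grad_y gradg u q) z - ystar u) <=
    ((lg1 - mu) / (lg1 + mu)) ^+ K * norm2 (z - ystar u).
Proof.
move=> Xu mu_le; elim: K => [|K IH]; first by rewrite expr0 mul1r.
rewrite iterS exprS -mulrA.
apply: le_trans (gradient_step_contraction _ mu_gt0 mu_le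
  (fun z q => g_slice_deriv z q Xu) (g_strong Xu) _ (grad_y_ystar Xu)) _.
  move=> q q'; rewrite /grad_y -dsubmxB (le_trans (norm2_dsubmx _))//.
  rewrite (le_trans (gradg_lip (Zcol _ Xu) (Zcol _ Xu)))//.
  by rewrite opp_col_mx add_col_mx subrr norm2_col_0mx.
by rewrite ler_wpM2l// divr_ge0 ?subr_ge0// addr_ge0// ltW.
Qed.

(** The case of a start at [ystar u] is separate because [mu <= lg1] may fail
    when the lower level has dimension [0]. *)
Lemma inner_loop_rate u z K t : X u -> (0 < t)%N ->
  ln (2 * t%:R) <= K%:R * (2 / (lg1 / mu + 1)) ->
  norm2 (iter K (fun q => q - (2 / (lg1 + mu)) *: grad_y gradg u q) z - ystar u) <=
    inner_rate (2 / (lg1 / mu + 1)) t * norm2 (z - ystar u).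
Proof.
move=> Xu t0 hK; have [/eqP|z0] := eqVneq (z - ystar u) 0.
  rewrite subr_eq0 => /eqP ->.
  by rewrite iter_fix ?subrr ?norm2_0 ?mulr0// grad_y_ystar// scaler0 subr0.
have mu_le := mu_le_lg1 Xu z0.
apply: le_trans (inner_loop_contraction z K Xu mu_le) _.
rewrite ler_wpM2r ?norm2_ge0//.
have k1 : 1 <= lg1 / mu by rewrite ler_pdivlMr// mul1r.
have -> : (lg1 - mu) / (lg1 + mu) = 1 - 2 / (lg1 / mu + 1).
  by field; rewrite !gt_eqF ?ltr_wpDl.
apply: contraction_le_inner_rate => //.
by rewrite divr_gt0 ?ltr_wpDl ?(le_trans ler01 k1)//= ler_pdivrMr ?mul1r; lra.
Qed.

(** Along a direction that stays in [X], the Lipschitz bound on the gradient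
    passes to its derivative. *)
Lemma hess_along u v (w : 'cV[R]_d1) : X u -> X (u + w) ->
  norm2 (hessg (col_mx u v) *m col_mx w 0) <= lg1 * norm2 w.
Proof.
move=> Xu Xuw.
have [->|/norm2_gt0 w0] := eqVneq w 0.
  by rewrite col_mx0 mulmx0 !norm2_0 mulr0.
apply/ler_addgt0Pr => e e0.
have e1 : 0 < e / norm2 w by rewrite divr_gt0.
have [d d0 hd] := jacobian_frechet (g_hess (Zcol v Xu)) e1.
have [s /andP[s0 s1] hs] := small_step d0 (ltW w0).
have Xs : X (u + s *: w).
  by have := X_segment Xu Xuw (s := s); rewrite addrKl; apply; rewrite (ltW s0) s1.
have ez : col_mx (u + s *: w) v - col_mx u v = s *: col_mx w 0.
  by rewrite opp_col_mx add_col_mx subrr addrKl scale_col_mx scaler0.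
have nz : norm2 (s *: col_mx w (0 : 'cV[R]_d2)) = s * norm2 w.
  by rewrite norm2Z gtr0_norm// norm2_col_mx0.
have := hd _ (Zcol v Xs); rewrite ez nz hs ?s0 ?lexx// => /(_ isT) h1.
have h2 := gradg_lip (Zcol v Xs) (Zcol v Xu).
rewrite ez nz in h2.
have -> : norm2 (hessg (col_mx u v) *m col_mx w 0) =
    s^-1 * norm2 (hessg (col_mx u v) *m (s *: col_mx w 0)).
  by rewrite -scalemxAr norm2Z gtr0_norm// mulKf// gt_eqF.
rewrite ler_pdivrMl//.
rewrite -[X in norm2 X](subKr (gradg (col_mx (u + s *: w) v) - gradg (col_mx u v))).
rewrite (le_trans (norm2B _ _))// mulrDr mulrCA lerD//.
by apply: le_trans h1 _; rewrite mulrCA divfK// gt_eqF.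
Qed.

(** The base point [u] need not see [a - b] as a feasible direction, but points
    of the segment from [u] to [b] arbitrarily close to [u] do. *)
Lemma hess_tangent u v a b : X u -> X a -> X b ->
  norm2 (dlsubmx (hessg (col_mx u v)) *m (a - b)) <= lg1 * norm2 (a - b).
Proof.
move=> Xu Xa Xb; set w := a - b.
apply/ler_addgt0Pr => e e0.
have c0 : 0 <= lg2 * norm2 (b - u) * norm2 w by rewrite !mulr_ge0 ?norm2_ge0.
have [s /andP[s0 s1] hs] := small_step e0 c0.
have s01 : 0 <= s <= 1 by rewrite ltW.
have Xb' := X_segment Xu Xb s01; have Xa' := X_segment Xu Xa s01.
have h1 : norm2 (hessg (col_mx (u + s *: (b - u)) v) *m col_mx w 0) <= lg1 * norm2 w.
  have := hess_along v (w := s *: w) Xb'.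
  have -> : u + s *: (b - u) + s *: w = u + s *: (a - u).
    by rewrite -addrA -scalerDr [b - u + _]addrC subrKA.
  move=> /(_ Xa').
  have -> : col_mx (s *: w) (0 : 'cV[R]_d2) = s *: col_mx w 0.
    by rewrite scale_col_mx scaler0.
  by rewrite -scalemxAr !norm2Z mulrCA ler_pM2l// gtr0_norm.
have -> : dlsubmx (hessg (col_mx u v)) *m w = dsubmx (hessg (col_mx u v) *m col_mx w 0).
  by rewrite dsubmx_mul_col mulmx0 addr0.
rewrite (le_trans (norm2_dsubmx _))//.
rewrite -[hessg (col_mx u v)](subrKC (hessg (col_mx (u + s *: (b - u)) v))) mulmxDl.
rewrite (le_trans (norm2D _ _))// lerD//.
rewrite (le_trans (norm2_mulmx_le _ _))// norm2_col_mx0.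
rewrite (le_trans (ler_wpM2r (norm2_ge0 w) (hessg_lip (Zcol v Xu) (Zcol v Xb'))))//.
rewrite opp_col_mx add_col_mx subrr norm2_col_mx0 norm2_distC addrKl norm2Z gtr0_norm//.
have -> : lg2 * (s * norm2 (b - u)) * norm2 w = s * (lg2 * norm2 (b - u) * norm2 w) by ring.
by rewrite ltW// hs// s0 lexx.
Qed.

(** [M] solves the equation with [hess_yy] on its right, so its transpose solves
    the one with the transposed Hessian: symmetry is what identifies
    [M^T w] with the derivative of [ystar] along [w]. *)
Lemma adjoint_eq u v (w : 'cV[R]_d1) : X u ->
  hess_yy hessg u v *m ((M u v)^T *m w) = - (dlsubmx (hessg (col_mx u v)) *m w).
Proof.
move=> Xu.
rewrite -(hessian_sym (fun z q => g_slice_deriv z q Xu) (grad_y_slice_frechet v Xu)).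
rewrite mulmxA -trmx_mul.
have /eqP := M_solves v Xu; rewrite addr_eq0 => /eqP ->.
by rewrite /hess_xy linearN /= trmxK mulNmx.
Qed.

Lemma adjoint_bound u v a b : X u -> X a -> X b ->
  norm2 ((M u v)^T *m (a - b)) <= lg1 / mu * norm2 (a - b).
Proof.
move=> Xu Xa Xb; rewrite mulrAC ler_pdivlMr// mulrC.
rewrite (le_trans (hess_yy_lower v _ Xu))// adjoint_eq// norm2N.
exact: hess_tangent.
Qed.

(** The two solutions differ by the solution for the right-hand side
    [(H' - H) (w, n')], a single application of the Hessian increment. *)
Lemma adjoint_lip u v u' v' a b : X u -> X u' -> X a -> X b ->
  norm2 ((M u v)^T *m (a - b) - (M u' v')^T *m (a - b)) <=
    lg2 / mu * (1 + lg1 / mu) * norm2 (col_mx u v - col_mx u' v') * norm2 (a - b).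
Proof.
move=> Xu Xu' Xa Xb; set w := a - b; set n := (M u v)^T *m w; set n' := (M u' v')^T *m w.
have : mu * norm2 (n - n') <= lg2 * norm2 (col_mx u v - col_mx u' v') *
    (norm2 w + lg1 / mu * norm2 w).
  rewrite (le_trans (hess_yy_lower v _ Xu))// mulmxBr adjoint_eq//.
  have -> : - (dlsubmx (hessg (col_mx u v)) *m w) - hess_yy hessg u v *m n' =
      - dsubmx ((hessg (col_mx u v) - hessg (col_mx u' v')) *m col_mx w n').
    rewrite mulmxBl dsubmxB !dsubmx_mul_col opprB.
    have -> : dlsubmx (hessg (col_mx u' v')) *m w = - (hess_yy hessg u' v' *m n').
      by rewrite adjoint_eq// opprK.
    by rewrite /hess_yy addNr add0r opprD.
  rewrite norm2N (le_trans (norm2_dsubmx _))// (le_trans (norm2_mulmx_le _ _))//.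
  rewrite ler_pM ?norm2_ge0 ?opnorm_ge0//.
    by apply: hessg_lip; apply: Zcol.
  by rewrite (le_trans (norm2_col_mx_le _ _))// lerD2l adjoint_bound.
rewrite -ler_pdivlMl// => /le_trans; apply.
by rewrite le_eqVlt; apply/orP; left; apply/eqP; field; rewrite gt_eqF.
Qed.

Lemma grad_y_f_bound u v : X u -> norm2 (grad_y gradf u v) <= lf0.
Proof.
move=> Xu; apply: norm2_le_dot => // p.
apply: dir_deriv_le (dir_deriv_slice p Xu (f_grad (Zcol v Xu))) => s /andP[s0 _].
rewrite (le_trans (f_lip (Zcol _ Xu) (Zcol _ Xu)))//.
by rewrite opp_col_mx add_col_mx subrr norm2_col_0mx addrKl norm2Z gtr0_norm// mulrCA.
Qed.

Local Notation hg := (hypergrad gradf M).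

Lemma dot_hypergrad u v w :
  dot (hg u v) w = dot (grad_x gradf u v) w + dot (grad_y gradf u v) ((M u v)^T *m w).
Proof. by rewrite /hypergrad dotDl dot_mulmxl. Qed.

(** Against tangent vectors only: the component of the hypergradient orthogonal
    to the affine hull of [X] is not controlled by the data. *)
Lemma hypergrad_lip u v u' v' a b : X u -> X u' -> X a -> X b ->
  dot (hg u v - hg u' v') (a - b) <=
    const_Mf lf0 lf1 lg1 lg2 mu * norm2 (col_mx u v - col_mx u' v') * norm2 (a - b).
Proof.
move=> Xu Xu' Xa Xb; rewrite dotBl !dot_hypergrad.
have hx : dot (grad_x gradf u v - grad_x gradf u' v') (a - b) <=
    lf1 * norm2 (col_mx u v - col_mx u' v') * norm2 (a - b).
  rewrite (le_trans (dot_le _ _))// ler_wpM2r ?norm2_ge0//.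
  rewrite /grad_x -usubmxB (le_trans (norm2_usubmx _))//.
  by apply: gradf_lip; apply: Zcol.
have hy : dot (grad_y gradf u v - grad_y gradf u' v') ((M u' v')^T *m (a - b)) <=
    lf1 * norm2 (col_mx u v - col_mx u' v') * (lg1 / mu * norm2 (a - b)).
  rewrite (le_trans (dot_le _ _))// ler_pM ?norm2_ge0//; last exact: adjoint_bound.
  rewrite /grad_y -dsubmxB (le_trans (norm2_dsubmx _))//.
  by apply: gradf_lip; apply: Zcol.
have hM : dot (grad_y gradf u v) ((M u v)^T *m (a - b) - (M u' v')^T *m (a - b)) <=
    lf0 * (lg2 / mu * (1 + lg1 / mu) * norm2 (col_mx u v - col_mx u' v') * norm2 (a - b)).
  rewrite (le_trans (dot_le _ _))// ler_pM ?norm2_ge0//; first exact: grad_y_f_bound.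
  exact: adjoint_lip.
move: hx hy hM; set w := a - b; clearbody w.
rewrite !dotBl dotBr /const_Mf.
set N := norm2 (col_mx _ _ - _); set W := norm2 w => hx hy hM.
have -> : (lf1 + lg1 * lf1 / mu + lf0 / mu * (lg2 + lg1 * lg2 / mu)) * N * W =
  lf1 * N * W + lf1 * N * (lg1 / mu * W) + lf0 * (lg2 / mu * (1 + lg1 / mu) * N * W) by ring.
lra.
Qed.

Local Notation F := (outer f ystar).

(** Implicit differentiation: [grad_y g] vanishes at [ystar], so the increment
    [dy] of [ystar] satisfies [H_yy dy = - s J d + o(s)], where [J] is the mixed
    block of the Hessian and [d = u' - u]; whence [dy = s M^T d + o(s)]. *)
Lemma outer_dir_deriv u u' : X u -> X u' ->
  dir_deriv F u (u' - u) (dot (hg u (ystar u)) (u' - u)).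
Proof.
move=> Xu Xu' e e0; set d := u' - u.
set c := (1 + lg1 / mu) * norm2 d.
have c0 : 0 <= c by rewrite mulr_ge0 ?norm2_ge0// addr_ge0// divr_ge0// ltW.
have k0 : 0 <= lf0 / mu + 1 by rewrite addr_ge0// divr_ge0// ltW.
set e1 := e / ((lf0 / mu + 1) * c + 1).
have e10 : 0 < e1 by rewrite divr_gt0// ltr_wpDl// (mulr_ge0 k0 c0).
set z := col_mx u (ystar u).
have [a a0 ha] := gradient_epsilon (f_grad (Zcol (ystar u) Xu)) e10.
have [b b0 hb] := jacobian_frechet (g_hess (Zcol (ystar u) Xu)) e10.
have ab0 : 0 < Num.min a b by rewrite lt_min a0.
have [s0 /andP[s00 s01] hs0] := small_step ab0 c0.
exists s0 => // s /andP[sp ss].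
have Xs : X (u + s *: d) by apply: X_segment; rewrite // (ltW sp) (le_trans ss).
set dy := ystar (u + s *: d) - ystar u.
set dz := col_mx (s *: d) dy.
have ndz : norm2 dz <= s * c.
  rewrite (le_trans (norm2_col_mx_le _ _))// norm2Z gtr0_norm// /c mulrA mulrDr mulr1.
  rewrite mulrDl lerD2l (le_trans (ystar_lip Xs Xu))//.
  by rewrite addrKl norm2Z gtr0_norm// mulrCA mulrA.
have ez : col_mx (u + s *: d) (ystar (u + s *: d)) - z = dz.
  by rewrite opp_col_mx add_col_mx addrKl.
have : norm2 dz < Num.min a b by rewrite (le_lt_trans ndz)// hs0// sp.
rewrite lt_min => /andP[dza dzb].
have := ha _ (Zcol (ystar (u + s *: d)) Xs); rewrite ez => /(_ dza) hf.
have := hb _ (Zcol (ystar (u + s *: d)) Xs); rewrite ez => /(_ dzb) hgr.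
set n := (M u (ystar u))^T *m d.
have hq : mu * norm2 (dy - s *: n) <= e1 * (s * c).
  rewrite (le_trans (hess_yy_lower (ystar u) _ Xu))//.
  rewrite mulmxBr -scalemxAr adjoint_eq// scalerN opprK.
  have -> : hess_yy hessg u (ystar u) *m dy + s *: (dlsubmx (hessg (col_mx u (ystar u))) *m d) =
      - dsubmx (gradg (col_mx (u + s *: d) (ystar (u + s *: d))) - gradg z - hessg z *m dz).
    rewrite !dsubmxB dsubmx_mul_col.
    have /= := grad_y_ystar Xs; rewrite /grad_y => ->.
    have /= := grad_y_ystar Xu; rewrite /grad_y => ->.
    by rewrite subr0 sub0r opprK -scalemxAr addrC.
  rewrite norm2N (le_trans (norm2_dsubmx _))// (le_trans hgr)// ler_pM2l//.
have -> : F (u + s *: d) - F u - s * dot (hg u (ystar u)) d =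
    (f (col_mx (u + s *: d) (ystar (u + s *: d))) - f z - dot (gradf z) dz)
    + dot (grad_y gradf u (ystar u)) (dy - s *: n).
  rewrite /outer dot_hypergrad -/n -[gradf z]vsubmxK dot_col_mx.
  by rewrite /grad_x /grad_y -/z [dot _ (dy - _)]dotBr !dotZr; ring.
have hq' : `|dot (grad_y gradf u (ystar u)) (dy - s *: n)| <= lf0 * (e1 * (s * c) / mu).
  rewrite (le_trans (cauchy_schwarz _ _))// ler_pM ?norm2_ge0//.
    exact: grad_y_f_bound.
  by rewrite ler_pdivlMr// mulrC.
have hf' : e1 * norm2 dz <= e1 * (s * c) by rewrite ler_pM2l.
rewrite (le_trans (ler_normD _ _))// (le_trans (lerD (le_trans hf hf') hq'))//.
have -> : e1 * (s * c) + lf0 * (e1 * (s * c) / mu) = e1 * ((lf0 / mu + 1) * c) * s by ring.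
rewrite ler_pM2r// /e1 mulrAC ler_pdivrMr ?ltr_wpDl ?(mulr_ge0 k0 c0)//.
by rewrite ler_pM2l// lerDl.
Qed.

Lemma const_Mf_ge0 : 0 <= const_Mf lf0 lf1 lg1 lg2 mu.
Proof.
have im : 0 <= mu^-1 by rewrite invr_ge0 ltW.
by rewrite /const_Mf; repeat first [exact: addr_ge0|apply: addr_ge0|apply: mulr_ge0].
Qed.

Lemma const_LfE :
  const_Lf lf0 lf1 lg1 lg2 mu = const_Mf lf0 lf1 lg1 lg2 mu * (1 + lg1 / mu).
Proof. by rewrite /const_Lf /const_Mf; ring. Qed.

Lemma outer_grad_lip u u' a b : X u -> X u' -> X a -> X b ->
  dot (hg u (ystar u) - hg u' (ystar u')) (a - b) <=
    const_Lf lf0 lf1 lg1 lg2 mu * norm2 (u - u') * norm2 (a - b).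
Proof.
move=> Xu Xu' Xa Xb; apply: le_trans (hypergrad_lip _ _ Xu Xu' Xa Xb) _.
rewrite ler_wpM2r ?norm2_ge0//.
rewrite const_LfE -mulrA ler_wpM2l//.
  exact: const_Mf_ge0.
rewrite opp_col_mx add_col_mx (le_trans (norm2_col_mx_le _ _))//.
by rewrite mulrDl mul1r lerD2l ystar_lip.
Qed.

(** The error of the approximate hypergradient enters only through its product
    with [x' - p], a tangent vector of length at most [D]. *)
Lemma oagd_round (alpha D eps : R) x x' p y :
  0 < alpha -> alpha * (4 * const_Lf lf0 lf1 lg1 lg2 mu) <= 1 ->
  (forall a b s, X a -> X b -> 0 <= s <= 1 ->
    F (a + s *: (b - a)) <= (1 - s) * F a + s * F b) ->
  X p -> has_gradient_within X F p 0 ->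
  (forall a b, X a -> X b -> norm2 (a - b) <= D) ->
  X x -> is_projection X (x - alpha *: hg x y) x' ->
  norm2 (y - ystar x) <= eps ->
  F x - F p <= alpha^-1 * (norm2 (x - p) ^+ 2 - norm2 (x' - p) ^+ 2)
    + 2 * (const_Mf lf0 lf1 lg1 lg2 mu * eps * D).
Proof.
move=> al0 alL Fcvx Xp Fp diam Xx pr hy.
have Mf0 := const_Mf_ge0.
have Lf0 : 0 <= const_Lf lf0 lf1 lg1 lg2 mu.
  by rewrite const_LfE mulr_ge0// addr_ge0// divr_ge0// ltW.
apply: (projected_step_gap X_segment Lf0 outer_dir_deriv Fcvx outer_grad_lip Xp _ al0 alL Xx pr).
  move=> u Xu; apply: dir_deriv_unique (outer_dir_deriv Xp Xu) _.
  rewrite -(dot0l (u - p)); apply: gradient_dir_deriv Fp => s /andP[s0 s1].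
  by apply: X_segment; rewrite // ltW.
rewrite (le_trans (hypergrad_lip _ _ Xx Xx pr.1 Xp))//.
rewrite opp_col_mx add_col_mx subrr norm2_col_0mx norm2_distC.
rewrite ler_pM ?norm2_ge0 ?diam ?ler_wpM2l//; last exact: pr.1.
by rewrite mulr_ge0 ?norm2_ge0.
Qed.

End Hypergradient.

(** * The regret bound *)

Theorem theorem7 (R : realType) (lf0 lf1 lg1 lg2 mu D D' alpha : R)
    (mu_gt0 : 0 < mu) (alpha_gt0 : 0 < alpha)
    (* alpha <= 1 / (4 L_f), with no constraint when L_f = 0 *)
    (alpha_le : alpha * (4 * const_Lf lf0 lf1 lg1 lg2 mu) <= 1) :
  exists C : R,
  forall (d1 d2 T : nat) (X : set 'cV[R]_d1)
    (f g : nat -> 'cV[R]_(d1 + d2) -> R)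
    (gradf gradg : nat -> 'cV[R]_(d1 + d2) -> 'cV[R]_(d1 + d2))
    (hessg : nat -> 'cV[R]_(d1 + d2) -> 'M[R]_(d1 + d2))
    (M : nat -> 'cV[R]_d1 -> 'cV[R]_d2 -> 'M[R]_(d1, d2))
    (ystar : nat -> 'cV[R]_d1 -> 'cV[R]_d2) (xstar : nat -> 'cV[R]_d1)
    (K : nat -> nat) (stepx stepy : nat -> R)
    (x : nat -> 'cV[R]_d1) (y : nat -> 'cV[R]_d2),
  let Z : set 'cV[R]_(d1 + d2) := cylinder X in
  X !=set0 -> closed X -> convex_set X ->
  (forall t, (1 <= t <= T)%N -> forall z, Z z ->
     [/\ has_gradient_within Z (f t) z (gradf t z),
         has_gradient_within Z (g t) z (gradg t z) &
         has_jacobian_within Z (gradg t) z (hessg t z)]) ->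
  (* (i) *)
  (forall t, (1 <= t <= T)%N -> forall z z', Z z -> Z z' ->
     `|f t z - f t z'| <= lf0 * norm2 (z - z')) ->
  (* (ii) *)
  (forall t, (1 <= t <= T)%N -> forall u, X u ->
     strongly_convex mu (fun v => g t (col_mx u v))) ->
  (* (iii) *)
  (forall t, (1 <= t <= T)%N -> forall z z', Z z -> Z z' ->
     [/\ norm2 (gradf t z - gradf t z') <= lf1 * norm2 (z - z'),
         norm2 (gradg t z - gradg t z') <= lg1 * norm2 (z - z') &
         opnorm (hessg t z - hessg t z') <= lg2 * norm2 (z - z')]) ->
  (* y_t^*(x), M_t(x, y) *)
  (forall t, (1 <= t <= T)%N -> forall u, X u ->
     is_argmin setT (fun v => g t (col_mx u v)) (ystar t u)) ->
  (forall t, (1 <= t <= T)%N -> forall u v, X u ->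
     M t u v *m hess_yy (hessg t) u v + hess_xy (hessg t) u v = 0) ->
  (* (iv) *)
  (forall u u', X u -> X u' -> norm2 (u - u') <= D) ->
  norm2 (y 1%N - ystar 1%N (x 1%N)) <= D' ->
  (* (v) *)
  (forall t, (1 <= t <= T)%N -> convex_function X (outer (f t) (ystar t))) ->
  (* (vi) *)
  (forall t, (1 <= t <= T)%N ->
     is_argmin X (outer (f t) (ystar t)) (xstar t) /\
     has_gradient_within X (outer (f t) (ystar t)) (xstar t) 0) ->
  (* parameters and iterates of the algorithm *)
  (forall t, (1 <= t <= T)%N ->
     [/\ stepx t = alpha,
         stepy t = 2 / (lg1 + mu) &
         (Num.ceil (1 / 4 * (lg1 / mu + 1) * ln (4 * t%:R ^+ 2) : R)
            < (K t)%:Z)%R]) ->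
  oagd T X gradf gradg M stepx stepy K x y ->
  BD_Reg T f ystar x xstar <=
    C * (1 + path_S 1 T ystar xstar + path_Y 2 T ystar xstar).
Proof.
pose kappa := lg1 / mu; pose u := 2 / (kappa + 1).
pose Mf := const_Mf lf0 lf1 lg1 lg2 mu.
pose C1 := alpha^-1 * (D ^+ 2 + 2 * D).
pose C2 := 2 * Mf * D * ((D' + 2 * (2 * kappa * D)) * (1 + 4 / u)).
pose C3 := 2 * Mf * D.
exists (`|C1| + `|C2| + `|C3|).
move=> d1 d2 T X f g gradf gradg hessg M ystar xstar K stepx stepy x y Z.
move=> _ _ Xcvx hder hf hstrong hlip hys hM diam hD' hcvx hmin hpar [Xx1 hoagd].
have P10 : 0 <= path_P 1 T xstar by apply: sumr_ge0 => t _; rewrite exprn_ge0 ?norm2_ge0.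
have Y10 : 0 <= path_Y 1 T ystar xstar.
  by apply: sumr_ge0 => t _; rewrite exprn_ge0 ?norm2_ge0.
have Y20 : 0 <= path_Y 2 T ystar xstar.
  by apply: sumr_ge0 => t _; rewrite exprn_ge0 ?norm2_ge0.
have RHS0 : 0 <= (`|C1| + `|C2| + `|C3|) *
    (1 + path_S 1 T ystar xstar + path_Y 2 T ystar xstar).
  by rewrite mulr_ge0 ?addr_ge0.
have X_segment a b s : X a -> X b -> 0 <= s <= 1 -> X (a + s *: (b - a)).
  move=> Xa Xb /andP[s0 s1].
  have := Xcvx b a (Itv01 s0 s1); rewrite !inE => /(_ Xb Xa).
  rewrite /conv /= => h; move: h; congr (X _).
  by rewrite scalerBr scalerBl scale1r addrCA.
have Xx t : (1 <= t <= T.+1)%N -> X (x t).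
  case: t => [//|[_ //|t]] /andP[_ tT].
  by have [_ [? _]] := hoagd t.+1 tT.
have Xxs t : (1 <= t <= T)%N -> X (xstar t) by move=> /hmin[[]].
(* If [X] is a point the regret vanishes; two distinct points force the Lipschitz
   constants to be nonnegative. *)
have [->|[T0 [a [b [Xa Xb ab]]]]] : BD_Reg T f ystar x xstar = 0 \/
    ((0 < T)%N /\ exists a b, [/\ X a, X b & a != b]).
- case: T {P10 Y10 Y20 RHS0 hder hf hstrong hlip hys hM hcvx hmin hpar hoagd} Xx Xxs => [|T] Xx Xxs.
    by left; rewrite /BD_Reg big_geq.
  have [|Xone] := pselect (exists a b, [/\ X a, X b & a != b]); first by right.
  left; rewrite /BD_Reg big_nat_cond big1// => t; rewrite andbT ltnS => tT.
  have [->|ne] := eqVneq (x t) (xstar t); first by rewrite subrr.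
  case: Xone; exists (x t), (xstar t); split=> //; last exact: Xxs.
  by apply: Xx; case/andP: tT => -> /= /leqW.
- exact: RHS0.
have nab : 0 < norm2 (a - b) by rewrite norm2_gt0// subr_eq0.
have D0 : 0 <= D by rewrite (le_trans (ltW nab))// diam.
have Zcol t v : X t -> Z (col_mx t v) by rewrite /Z /cylinder /= col_mxKu.
pose za : 'cV[R]_(d1 + d2) := col_mx a 0; pose zb : 'cV[R]_(d1 + d2) := col_mx b 0.
have Za : Z za by exact: Zcol.
have Zb : Z zb by exact: Zcol.
have nz : norm2 (za - zb) = norm2 (a - b).
  by rewrite opp_col_mx add_col_mx subrr norm2_col_mx0.
have T1 : (1 <= 1 <= T)%N by [].
have nonneg (l v : R) : 0 <= v -> v <= l * norm2 (za - zb) -> 0 <= l.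
  by move=> v0 /(le_trans v0); rewrite nz pmulr_lge0.
have lf0_ge0 := nonneg _ _ (normr_ge0 _) (hf 1%N T1 za zb Za Zb).
have [h1 h2 h3] := hlip 1%N T1 za zb Za Zb.
have lf1_ge0 := nonneg _ _ (norm2_ge0 _) h1.
have lg1_ge0 := nonneg _ _ (norm2_ge0 _) h2.
have lg2_ge0 := nonneg _ _ (opnorm_ge0 _) h3.
have kappa0 : 0 <= kappa by rewrite divr_ge0// ltW.
have u0 : 0 < u by rewrite divr_gt0// ltr_wpDl.
have Mf0 : 0 <= Mf by exact: const_Mf_ge0.
pose delta t := norm2 (y t - ystar t (x t)).
pose q t := inner_rate u t.
pose Pt t := norm2 (xstar t.-1 - xstar t).
pose Yt t := norm2 (ystar t.-1 (xstar t.-1) - ystar t (xstar t)).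
have f_grad t (tT : (1 <= t <= T)%N) z (Zz : Z z) : has_gradient_within Z (f t) z (gradf t z).
  by have [] := hder t tT z Zz.
have g_grad t (tT : (1 <= t <= T)%N) z (Zz : Z z) : has_gradient_within Z (g t) z (gradg t z).
  by have [] := hder t tT z Zz.
have g_hess t (tT : (1 <= t <= T)%N) z (Zz : Z z) :
    has_jacobian_within Z (gradg t) z (hessg t z).
  by have [] := hder t tT z Zz.
have gradf_lip t (tT : (1 <= t <= T)%N) z z' (Zz : Z z) (Zz' : Z z') :
    norm2 (gradf t z - gradf t z') <= lf1 * norm2 (z - z').
  by have [] := hlip t tT z z' Zz Zz'.
have gradg_lip t (tT : (1 <= t <= T)%N) z z' (Zz : Z z) (Zz' : Z z') :
    norm2 (gradg t z - gradg t z') <= lg1 * norm2 (z - z').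
  by have [] := hlip t tT z z' Zz Zz'.
have hessg_lip t (tT : (1 <= t <= T)%N) z z' (Zz : Z z) (Zz' : Z z') :
    opnorm (hessg t z - hessg t z') <= lg2 * norm2 (z - z').
  by have [] := hlip t tT z z' Zz Zz'.
have XxT t : (1 <= t <= T)%N -> X (x t).
  by move=> /andP[t1 tT]; apply: Xx; rewrite t1 leqW.
(* [4 t^2 = (2 t)^2], so the number of inner steps is at least
   [(kappa + 1) ln (2 t) / 2 = ln (2 t) / u]. *)
have inner t : (1 <= t <= T)%N -> norm2 (y t.+1 - ystar t (x t)) <= q t * delta t.
  move=> tT; have [-> _] := hoagd t tT; have [_ -> hK] := hpar t tT.
  have t0 : (0 < t)%N by case/andP: tT.
  apply: (inner_loop_rate lg1_ge0 mu_gt0 (g_grad t tT) (hstrong t tT)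
    (gradg_lip t tT) (hys t tT) (y t) (XxT t tT) t0).
  have k1 : 0 < kappa + 1 by rewrite ltr_wpDl.
  rewrite -/kappa mulrA ler_pdivlMr//.
  have : 1 / 4 * (kappa + 1) * ln (4 * t%:R ^+ 2) <= (K t)%:R.
    by have := ltW hK; rewrite ceil_le_int.
  have t1 : 0 < t%:R :> R by rewrite ltr0n.
  have -> : 4 * t%:R ^+ 2 = (2 * t%:R) * (2 * t%:R) :> R by ring.
  by rewrite lnM ?posrE ?mulr_gt0//; lra.
have round t : (1 <= t <= T)%N ->
    outer (f t) (ystar t) (x t) - outer (f t) (ystar t) (xstar t) <=
    alpha^-1 * (norm2 (x t - xstar t) ^+ 2 - norm2 (x t.+1 - xstar t) ^+ 2)
    + 2 * (Mf * (q t * delta t) * D).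
  move=> tT; have [_ pr] := hoagd t tT; have [ex _ _] := hpar t tT.
  rewrite ex in pr; have [[Xp _] Fp] := hmin t tT.
  apply: (oagd_round lf0_ge0 lf1_ge0 lg1_ge0 lg2_ge0 mu_gt0 X_segment (f_grad t tT)
    (g_grad t tT) (g_hess t tT) (hf t tT) (hstrong t tT) (gradf_lip t tT)
    (gradg_lip t tT) (hessg_lip t tT) (hys t tT) (hM t tT) alpha_gt0 alpha_le
    _ Xp Fp diam (XxT t tT) pr (inner t tT)).
  move=> a' b' s Xa' Xb' /andP[s0 s1].
  have := hcvx t tT (Itv01 s0 s1) b' a'; rewrite !inE => /(_ Xb' Xa').
  rewrite /conv /= => h.
  have e1 : a' + s *: (b' - a') = s *: b' + (1 - s) *: a'.
    by rewrite scalerBr scalerBl scale1r addrCA.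
  by rewrite e1 [leRHS]addrC.
(* Between two rounds the lower-level minimiser moves from [ystar t (x t)] to
   [ystar t.+1 (x t.+1)]: through the comparators this costs [2 kappa D + Yt]. *)
have hdelta : \sum_(1 <= t < T.+1) q t * delta t <=
    (D' + 2 * (2 * kappa * D)) * (\sum_(1 <= t < T.+1) q t) + \sum_(2 <= t < T.+1) Yt t.
  apply: tracking_error_sum => //.
  - by rewrite mulr_ge0// mulr_ge0.
  - move=> t /andP[t0 _]; rewrite expR_ge0 inner_rate_half// ltW//.
  - by move=> t; rewrite norm2_ge0.
  - by move=> t; rewrite norm2_ge0.
  move=> t /andP[t0 tT]; have tT1 : (1 <= t <= T)%N by rewrite t0 ltnW.
  have tT2 : (1 <= t.+1 <= T)%N by [].
  have i1 := inner t tT1.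
  have i2 := ystar_lip lg1_ge0 mu_gt0 (g_grad t tT1) (hstrong t tT1)
    (gradg_lip t tT1) (hys t tT1) (XxT t tT1) (Xxs t tT1).
  have i3 := ystar_lip lg1_ge0 mu_gt0 (g_grad t.+1 tT2) (hstrong t.+1 tT2)
    (gradg_lip t.+1 tT2) (hys t.+1 tT2) (Xxs t.+1 tT2) (XxT t.+1 tT2).
  have j2 := ler_wpM2l kappa0 (diam _ _ (XxT t tT1) (Xxs t tT1)).
  have j3 := ler_wpM2l kappa0 (diam _ _ (Xxs t.+1 tT2) (XxT t.+1 tT2)).
  have k1 := norm2_tri (y t.+1) (ystar t (x t)) (ystar t.+1 (x t.+1)).
  have k2 := norm2_tri (ystar t (x t)) (ystar t (xstar t)) (ystar t.+1 (x t.+1)).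
  have k3 := norm2_tri (ystar t (xstar t)) (ystar t.+1 (xstar t.+1)) (ystar t.+1 (x t.+1)).
  rewrite /delta /Yt /=; rewrite -/kappa in i2 i3; rewrite -/(delta t); lra.
have hq : \sum_(1 <= t < T.+1) q t <= 1 + 4 / u by apply: inner_rate_sum.
have htel : \sum_(1 <= t < T.+1)
    (norm2 (x t - xstar t) ^+ 2 - norm2 (x t.+1 - xstar t) ^+ 2) <=
    D ^+ 2 + 2 * D * (\sum_(2 <= t < T.+1) Pt t).
  apply: (@drifting_telescope _ (fun t => norm2 (x t - xstar t))
      (fun t => norm2 (x t.+1 - xstar t))) => t.
  - by move=> tT; rewrite norm2_ge0 diam//; [exact: XxT|exact: Xxs].
  - move=> /[dup] tT /andP[t0 t1]; rewrite norm2_ge0 diam//; last exact: Xxs.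
    by apply: Xx; rewrite ltnS.
  - exact: norm2_ge0.
  - by move=> _; exact: norm2_tri.
have eP : path_P 1 T xstar = \sum_(2 <= t < T.+1) Pt t by [].
have eY : path_Y 1 T ystar xstar = \sum_(2 <= t < T.+1) Yt t by [].
have reg : BD_Reg T f ystar x xstar <=
    alpha^-1 * (D ^+ 2 + 2 * D * path_P 1 T xstar)
    + 2 * Mf * D * ((D' + 2 * (2 * kappa * D)) * (1 + 4 / u) + path_Y 1 T ystar xstar).
  apply: (@le_trans _ _ (\sum_(1 <= t < T.+1)
     (alpha^-1 * (norm2 (x t - xstar t) ^+ 2 - norm2 (x t.+1 - xstar t) ^+ 2)
      + 2 * (Mf * (q t * delta t) * D)))).
    by apply: ler_sum_nat => t; rewrite ltnS => /round.
  rewrite big_split/= -mulr_sumr lerD//.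
    by rewrite ler_pM2l ?invr_gt0// eP.
  have eE t : 2 * (Mf * (q t * delta t) * D) = 2 * Mf * D * (q t * delta t) by ring.
  under eq_bigr do rewrite eE.
  have D'0 : 0 <= D' := le_trans (norm2_ge0 _) hD'.
  have drift0 : 0 <= 2 * kappa * D by apply: mulr_ge0 => //; apply: mulr_ge0.
  have MfD0 : 0 <= 2 * Mf * D by apply: mulr_ge0 => //; apply: mulr_ge0.
  rewrite -mulr_sumr (ler_wpM2l MfD0)// (le_trans hdelta)// eY lerD2r.
  by rewrite ler_wpM2l// addr_ge0// mulr_ge0.
apply: le_trans reg _.
rewrite -/C3 [C3 * _]mulrDr -/C2 /path_S.
set P := path_P 1 T xstar in P10 *; set Y1 := path_Y 1 T ystar xstar in Y10 *.
set Y2 := path_Y 2 T ystar xstar in Y20 *.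
have hC1 : alpha^-1 * (D ^+ 2 + 2 * D * P) <= C1 * (1 + P).
  have al1 : 0 <= alpha^-1 by rewrite invr_ge0 ltW.
  have -> : C1 * (1 + P) = alpha^-1 * (D ^+ 2 + 2 * D * P)
      + alpha^-1 * (D ^+ 2 * P + 2 * D) by rewrite /C1; ring.
  by rewrite lerDl mulr_ge0// addr_ge0 ?mulr_ge0.
have S1 : 1 + P <= 1 + (P + Y1) + Y2 by lra.
have S2 : 1 <= 1 + (P + Y1) + Y2 by lra.
have S3 : Y1 <= 1 + (P + Y1) + Y2 by lra.
have S0 : 0 <= 1 + P by lra.
have bound (c r r' : R) : 0 <= r -> r <= r' -> c * r <= `|c| * r'.
  by move=> r0 rr'; rewrite (le_trans (ler_wpM2r r0 (ler_norm c)))// ler_wpM2l.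
have -> : (`|C1| + `|C2| + `|C3|) * (1 + (P + Y1) + Y2) =
    `|C1| * (1 + (P + Y1) + Y2) + (`|C2| * (1 + (P + Y1) + Y2)
    + `|C3| * (1 + (P + Y1) + Y2)) by ring.
apply: lerD; first by apply: le_trans hC1 _; apply: bound.
by apply: lerD; [rewrite -[leLHS]mulr1; apply: bound|apply: bound].
Qed.
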